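(* Let $(M,\omega)$ be a symplectic $G$-space, $*$ a $G$-invariant star product on $M$, and $\Phi_*$ a quantum moment map for $*$ with classical part $\Phi_0$. Then $\Phi_*$ is differentiable. Moreover, if $*$ is of Fedosov type, then there are functions $S_{I,j}\in C^\infty(M)$, indexed by multi-indices $I=(i_1,\ldots,i_n)$ ($n=\dim\mathfrak g$) and $j=0,1,2,\ldots$, such that $$\Phi_*(u)=\sum_{j=0}^\infty \lambda^j\sum_{0\le |I|\le 2j} S_{I,j}\,\Phi_0(D_\mu^I u)\qquad\text{for any } u=u(\mu)\in C^\infty(\mathfrak g^* ),$$ where for non-polynomial $u$ the symbol $\Phi_*(u)$ denotes the differentiable extension of $\Phi_*$ to $C^\infty(\mathfrak g^* )$.
   Context: Setting. $G$ is a Lie group with finite-dimensional real Lie algebra $\mathfrak g$, acting on a symplectic manifold $(M,\omega)$ by symplectomorphisms. Function spaces $C^\infty(\cdot)$ consist of complex-valued smooth functions; $\lambda$ is a formal parameter. A star product on $M$ is an associative $\mathbb C[[\lambda]]$-bilinear product on $C^\infty(M)[[\lambda]]$ of the form $u*v=uv+\sum_{n\ge1}(\lambda/2)^nC_n(u,v)$, with $C_n$ bidifferential operators annihilating constants and $C_1(u,v)-C_1(v,u)=2\{u,v\}$. It is $G$-invariant if $g(u*v)=gu*gv$ for all $g\in G$, where $(gu)(x)=u(g^{-1}x)$. Write $[a,b]_*=a*b-b*a$. $\mathfrak g_\lambda=\mathfrak g[[\lambda]]$ has the $\lambda$-bilinear bracket with $[\xi,\eta]_\lambda=\lambda[\xi,\eta]$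 for $\xi,\eta\in\mathfrak g$. With the symmetrization map $s$ from the symmetric algebra (identified with $\mathrm{Pol}(\mathfrak g^* )[[\lambda]]$, polynomials on $\mathfrak g^*$) to the universal enveloping algebra $\mathfrak U(\mathfrak g_\lambda)$, the Gutt star product is $u*^Gv=s^{-1}(s(u)\cdot s(v))$; it extends uniquely to a differentiable product on $C^\infty(\mathfrak g^* )[[\lambda]]$. Through $s$, $\mathfrak U(\mathfrak g_\lambda)$ is identified with $(\mathrm{Pol}(\mathfrak g^* )[[\lambda]],*^G)$. A quantum moment map for a $G$-invariant star product $*$ is a ($\mathbb C[[\lambda]]$-linear) homomorphism of associative algebras $\Phi_*:\mathfrak U(\mathfrak g_\lambda)\cong(\mathrm{Pol}(\mathfrak g^* )[[\lambda]],*^G)\to(C^\infty(M)[[\lambda]],* )$ with $[\Phi_*(\xi),u]_*=\lambda\,\xi u$ for $\xi\in\mathfrak g$, $\xi u$ being the infinitesimal action of $\xi$ on $C^\infty(M)[[\lambda]]$. Then $\Phi_*(u)=\Phi_0(u)+O(\lambda)$ for $u\in\mathrm{Pol}(\mathfrak g^* )$, where $\Phi_0(u)=u\circ J$ for a classical moment map $J:M\to\mathfrak g^*$; the same formula defines $\Phi_0$ on $C^\infty(\mathfrak g^* )$. Fix linear coordinates $\mu=(\mu_1,\dots,\mu_n)$ on $\mathfrak g^*$ given by a basis $\{X_l\}$ of $\mathfrak g$, and put $D_\mu^I=(-i\partial_{\mu_1})^{i_1}\cdots(-i\partial_{\mu_n})^{i_n}$. ''$\Phi_*$ is differentiable'' means: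 writing $\Phi_*=\sum_j\lambda^j\Phi_j$ on $\mathrm{Pol}(\mathfrak g^* )$, each $\Phi_j$ is a differential operator along $J$, i.e. $\Phi_j(u)=\sum_I S_{I,j}\,\Phi_0(D^I_\mu u)$ with $S_{I,j}\in C^\infty(M)$ (locally finite sum). In that case the same formula defines the (unique) differentiable extension of $\Phi_*$ to $C^\infty(\mathfrak g^* )[[\lambda]]$. Fedosov type. The formal Weyl algebra $W_x$ ($x\in M$) consists of formal series $\sum\lambda^ka_{k,J}y^J$, $y$ linear coordinates on $T_xM$, with product $a\circ b=\sum_k(\lambda/2)^k\frac1{k!}\omega^{i_1j_1}\cdots\omega^{i_kj_k}\partial_{y^{i_1}}\cdots\partial_{y^{i_k}}a\;\partial_{y^{j_1}}\cdots\partial_{y^{j_k}}b$, filtered by $\deg y^j=1$, $\deg\lambda=2$; $\Gamma W$ denotes smooth sections of the resulting bundle $W\to M$. Given a torsion-free symplectic connection with induced covariant derivative $\partial$ on $\Gamma W$, a Fedosov connection is $Da=-\delta a+\partial a-\frac1\lambda[\gamma,a]$, $\delta a=dx^k\wedge\partial a/\partial y^k$, $\gamma\in\Gamma W\otimes\Lambda^1$, $\deg\gamma\ge3$, which is Abelian (its Weyl curvature is a scalar 2-form, so $D^2=0$). Let $W_D=\{a\in\Gamma W: Da=0\}$. The map $\sigma:W_D\to C^\infty(M)[[\lambda]]$, $\sigma(a)=a|_{y=0}$, is bijective with inverse $Q$. A star product is of Fedosov type if it has the form $a*b=\sigma(Q(a)\circ Q(b))$ for such a $D$. *)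

(* Defs.v *)
From HB Require Import structures.
From mathcomp Require Import all_boot all_order all_algebra all_fingroup.
From mathcomp Require Import all_classical all_reals all_analysis.
From mathcomp Require Import complex.
(* mpoly's notations clash with those of mathcomp-analysis. *)
From mathcomp Require Import -(notations) mpoly.

Set Implicit Arguments.
Unset Strict Implicit.
Unset Printing Implicit Defensive.
Import Order.TTheory GRing.Theory Num.Theory.
Import numFieldNormedType.Exports.
Local Open Scope classical_set_scope.
Local Open Scope ring_scope.

Definition partial (R : realType) (m : nat) (i : 'I_m) (f : 'rV[R]_m -> R) :
  'rV[R]_m -> R := fun y => 'D_(delta_mx 0 i) f y.

(* C^oo on an open set V: every iterated partial derivative exists and is
   continuous at the points of V. *)
Definition smooth_on (R : realType) (m : nat) (V : set 'rV[R]_m)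
    (f : 'rV[R]_m -> R) : Prop :=
  forall (s : seq 'I_m) (y : 'rV[R]_m), V y ->
    let g := foldr (@partial R m) f s in
    {for y, continuous g} /\ forall i : 'I_m, derivable g y (delta_mx 0 i).

Definition smooth_map_on (R : realType) (m p : nat) (V : set 'rV[R]_m)
    (F : 'rV[R]_m -> 'rV[R]_p) : Prop :=
  forall j : 'I_p, smooth_on V (fun y => F y 0 j).

Definition jacobian_mx (R : realType) (m p : nat) (F : 'rV[R]_m -> 'rV[R]_p)
    (y : 'rV[R]_m) : 'M[R]_(m, p) :=
  \matrix_(i, j) partial i (fun z => F z 0 j) y.

Definition csmooth_on (R : realType) (m : nat) (V : set 'rV[R]_m)
    (u : 'rV[R]_m -> R[i]) : Prop :=
  smooth_on V (fun y => complex.Re (u y)) /\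
  smooth_on V (fun y => complex.Im (u y)).

Definition cpartial (R : realType) (m : nat) (i : 'I_m)
    (u : 'rV[R]_m -> R[i]) : 'rV[R]_m -> R[i] :=
  fun y => (partial i (fun z => complex.Re (u z)) y
            +i* partial i (fun z => complex.Im (u z)) y)%C.

Definition cderiv (R : realType) (m : nat) (I : multinom m)
    (u : 'rV[R]_m -> R[i]) : 'rV[R]_m -> R[i] :=
  foldr (fun i v => iter (I i) (@cpartial R m i) v) u (enum 'I_m).

(* The atlas is indexed by [idx]. The homeomorphism [chart a] from [dom a] onto
   its image has inverse [param a]; the values of [chart a] outside [dom a], and
   of [param a] outside [chart a @` dom a], are irrelevant. *)
Record manifold (R : realType) (m : nat) : Type := Manifold {
  pts :> topologicalType;
  idx : Type;
  dom : idx -> set pts;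
  chart : idx -> pts -> 'rV[R]_m;
  param : idx -> 'rV[R]_m -> pts;
  mf_hausdorff : hausdorff_space pts;
  mf_countable : @second_countable pts;
  mf_open : forall a, open (dom a);
  mf_cover : forall x, exists a, dom a x;
  mf_img_open : forall a, open (chart a @` dom a);
  mf_chartK : forall a x, dom a x -> param a (chart a x) = x;
  mf_chart_cont : forall a x, dom a x -> {for x, continuous (chart a)};
  mf_param_cont : forall a x, dom a x ->
    {for chart a x, continuous (param a)};
  mf_compat : forall a b,
    smooth_map_on (chart a @` (dom a `&` dom b)) (chart b \o param a)
}.

Definition smooth_in (R : realType) (m : nat) (M : manifold R m) (V : set M)
    (f : M -> R) : Prop :=
  forall a : idx M, smooth_on (chart a @` (dom a `&` V)) (f \o param a).

Definition smooth (R : realType) (m : nat) (M : manifold R m) (f : M -> R) :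
  Prop := smooth_in setT f.

Definition csmooth_in (R : realType) (m : nat) (M : manifold R m) (V : set M)
    (u : M -> R[i]) : Prop :=
  smooth_in V (fun x => complex.Re (u x)) /\
  smooth_in V (fun x => complex.Im (u x)).

Definition csmooth (R : realType) (m : nat) (M : manifold R m)
    (u : M -> R[i]) : Prop := csmooth_in setT u.

Definition smooth_map (R : realType) (p q : nat) (A : manifold R p)
    (B : manifold R q) (F : A -> B) : Prop :=
  continuous F /\
  forall (a : idx A) (b : idx B),
    smooth_map_on (chart a @` (dom a `&` F @^-1` dom b))
      (chart b \o F \o param a).

(* Smoothness of a map on the product manifold A x B, whose charts are the
   products of the charts of A and B. *)
Definition smooth_map2 (R : realType) (p q r : nat) (A : manifold R p)
    (B : manifold R q) (E : manifold R r) (F : A -> B -> E) : Prop :=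
  continuous (fun z : A * B => F z.1 z.2) /\
  forall (a : idx A) (b : idx B) (c : idx E),
    let f (y : 'rV[R]_(p + q)) :=
      F (param a (lsubmx y)) (param b (rsubmx y)) in
    smooth_map_on
      [set y | [/\ (chart a @` dom a) (lsubmx y),
                   (chart b @` dom b) (rsubmx y) & dom c (f y)]]
      (chart c \o f).

Definition chart_partial (R : realType) (m : nat) (M : manifold R m)
    (a : idx M) (i : 'I_m) (f : M -> R) : M -> R :=
  fun x => partial i (f \o param a) (chart a x).

Definition chart_cpartial (R : realType) (m : nat) (M : manifold R m)
    (a : idx M) (i : 'I_m) (u : M -> R[i]) : M -> R[i] :=
  fun x => cpartial i (u \o param a) (chart a x).

Definition chart_cderiv (R : realType) (m : nat) (M : manifold R m)
    (a : idx M) (I : multinom m) (u : M -> R[i]) : M -> R[i] :=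
  fun x => cderiv I (u \o param a) (chart a x).

(* [jac b a x i p] is the derivative of the p-th coordinate of chart a along the
   i-th coordinate of chart b, so that the components (row vectors) of a tangent
   vector at x satisfy v_a = v_b *m jac b a x. *)
Definition jac (R : realType) (m : nat) (M : manifold R m) (b a : idx M)
    (x : M) : 'M[R]_m :=
  jacobian_mx (chart a \o param b) (chart b x).

Record symplectic_form (R : realType) (m : nat) (M : manifold R m) : Type :=
  SymplecticForm {
  omega : idx M -> M -> 'M[R]_m;
  omega_smooth : forall a i j, smooth_in (dom a) (fun x => omega a x i j);
  omega_tensor : forall a b x, dom a x -> dom b x ->
    omega b x = jac b a x *m omega a x *m (jac b a x)^T;
  omega_alt : forall a x, dom a x -> (omega a x)^T = - omega a x;
  omega_nondeg : forall a x, dom a x -> omega a x \in unitmx;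
  omega_closed : forall a x i j k, dom a x ->
    chart_partial a i (fun z => omega a z j k) x +
    chart_partial a j (fun z => omega a z k i) x +
    chart_partial a k (fun z => omega a z i j) x = 0
}.

(* The components omega^{ij}: omega^{ij} omega_{jk} = delta^i_k. *)
Definition omega_inv (R : realType) (m : nat) (M : manifold R m)
    (w : symplectic_form M) (a : idx M) (x : M) : 'M[R]_m :=
  invmx (omega w a x).

(* The expression of {u, v} at x in the chart a, for x in [dom a]. *)
Definition poisson (R : realType) (m : nat) (M : manifold R m)
    (w : symplectic_form M) (a : idx M) (u v : M -> R[i]) (x : M) : R[i] :=
  \sum_(i < m) \sum_(j < m) (omega_inv w a x i j)%:C%C *
    chart_cpartial a i u x * chart_cpartial a j v x.

Record lie_group (R : realType) (n : nat) : Type := LieGroup {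
  lg_mfd :> manifold R n;
  lg_mul : lg_mfd -> lg_mfd -> lg_mfd;
  lg_inv : lg_mfd -> lg_mfd;
  lg_one : lg_mfd;
  lg_mulA : associative lg_mul;
  lg_mul1 : left_id lg_one lg_mul;
  lg_mulV : left_inverse lg_one lg_inv lg_mul;
  lg_mul_smooth : smooth_map2 lg_mul;
  lg_inv_smooth : smooth_map lg_inv
}.

(* Vector fields are derivations of the algebra of smooth functions; their
   values on other functions are irrelevant. *)
Definition vector_field (R : realType) (m : nat) (M : manifold R m)
    (X : (M -> R) -> M -> R) : Prop :=
  [/\ forall f, smooth f -> smooth (X f),
      forall (c : R) f g, smooth f -> smooth g ->
        forall x, X (fun z => c * f z + g z) x = c * X f x + X g x
    & forall f g, smooth f -> smooth g ->
        forall x, X (fun z => f z * g z) x = X f x * g x + f x * X g x].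

Definition left_invariant (R : realType) (n : nat) (G : lie_group R n)
    (X : (G -> R) -> G -> R) : Prop :=
  forall f, smooth f ->
    forall g h, X (fun k => f (lg_mul g k)) h = X f (lg_mul g h).

(* The Lie algebra of G (left-invariant vector fields with the commutator
   bracket), through a basis X: an element is given by its coordinates
   xi : 'rV[R]_n. *)
Record lie_basis (R : realType) (n : nat) (G : lie_group R n) : Type :=
  LieBasis {
  lb_X : 'I_n -> (G -> R) -> G -> R;
  lb_field (xi : 'rV[R]_n) (f : G -> R) (g : G) : R :=
    \sum_(l < n) xi 0 l * lb_X l f g;
  lb_vector_field : forall l, vector_field (lb_X l);
  lb_left_invariant : forall l, left_invariant (lb_X l);
  lb_basis : forall Y, vector_field Y -> left_invariant Y ->
    exists! xi : 'rV[R]_n, forall f, smooth f ->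
      forall g, Y f g = lb_field xi f g;
  lb_bracket : 'rV[R]_n -> 'rV[R]_n -> 'rV[R]_n;
  lb_bracketE : forall xi eta f, smooth f -> forall g,
    lb_field (lb_bracket xi eta) f g =
    lb_field xi (lb_field eta f) g - lb_field eta (lb_field xi f) g
}.

Record symplectic_action (R : realType) (m n : nat) (G : lie_group R n)
    (M : manifold R m) (w : symplectic_form M) : Type := SymplecticAction {
  act : G -> M -> M;
  act_one : forall x, act (lg_one G) x = x;
  act_mul : forall g h x, act (lg_mul g h) x = act g (act h x);
  act_smooth : smooth_map2 act;
  act_symplectic : forall g a b x, dom a x -> dom b (act g x) ->
    let j := jacobian_mx (chart b \o act g \o param a) (chart a x) in
    omega w a x = j *m omega w b (act g x) *m j^T
}.

Definition cseries (R : realType) : Type := nat -> R[i].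

Definition cseries_cst (R : realType) (c : R[i]) : cseries R :=
  fun r => if r == 0%N then c else 0.

Definition cseries_mul (R : realType) (c d : cseries R) : cseries R :=
  fun r => \sum_(k < r.+1) c k * d (r - k)%N.

(* Elements of C^oo(M)[[lambda]] are the [fseries] that are [fsmooth]. *)
Definition fseries (R : realType) (m : nat) (M : manifold R m) : Type :=
  nat -> M -> R[i].

Definition fsmooth (R : realType) (m : nat) (M : manifold R m)
    (u : fseries M) : Prop := forall r, csmooth (u r).

Definition fseries_cst (R : realType) (m : nat) (M : manifold R m)
    (u : M -> R[i]) : fseries M :=
  fun r x => if r == 0%N then u x else 0.

Definition fseries_scale (R : realType) (m : nat) (M : manifold R m)
    (c : cseries R) (u : fseries M) : fseries M :=
  fun r x => \sum_(k < r.+1) c k * u (r - k)%N x.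

Definition bidifferential (R : realType) (m : nat) (M : manifold R m)
    (B : (M -> R[i]) -> (M -> R[i]) -> M -> R[i]) : Prop :=
  forall (a : idx M) (x : M), dom a x ->
    exists (V : set M) (N : nat) (c : multinom m -> multinom m -> M -> R[i]),
      [/\ open V, V x, V `<=` dom a,
          forall I J, csmooth_in V (c I J)
        & forall u v, csmooth u -> csmooth v -> forall z, V z ->
            B u v z = \sum_(I : bmultinom m N) \sum_(J : bmultinom m N)
              c I J z * chart_cderiv a I u z * chart_cderiv a J v z].

Definition star_of (R : realType) (m : nat) (M : manifold R m)
    (C : nat -> (M -> R[i]) -> (M -> R[i]) -> M -> R[i]) (u v : fseries M) :
  fseries M :=
  fun r x => \sum_(k < r.+1) \sum_(i < r.+1)
    \sum_(j < r.+1 | (k + i + j == r)%N) 2^-1 ^+ k * C k (u i) (v j) x.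

Record star_product (R : realType) (m : nat) (M : manifold R m)
    (w : symplectic_form M) : Type := StarProduct {
  sp_C : nat -> (M -> R[i]) -> (M -> R[i]) -> M -> R[i];
  sp_C0 : forall u v, csmooth u -> csmooth v ->
    forall x, sp_C 0 u v x = u x * v x;
  sp_bidiff : forall k, (0 < k)%N -> bidifferential (sp_C k);
  sp_const : forall k, (0 < k)%N -> forall (c : R[i]) u, csmooth u ->
    forall x, sp_C k (fun _ => c) u x = 0 /\ sp_C k u (fun _ => c) x = 0;
  sp_C1 : forall u v, csmooth u -> csmooth v -> forall a x, dom a x ->
    sp_C 1 u v x - sp_C 1 v u x = 2 * poisson w a u v x;
  sp_assoc : forall u v t, fsmooth u -> fsmooth v -> fsmooth t ->
    forall r x, star_of sp_C (star_of sp_C u v) t r x =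
                star_of sp_C u (star_of sp_C v t) r x
}.

Definition star (R : realType) (m : nat) (M : manifold R m)
    (w : symplectic_form M) (S : star_product w) (u v : fseries M) :
  fseries M := star_of (sp_C S) u v.

Definition translate (R : realType) (m n : nat) (G : lie_group R n)
    (M : manifold R m) (w : symplectic_form M) (A : symplectic_action G w)
    (g : G) (u : fseries M) : fseries M :=
  fun r x => u r (act A (lg_inv g) x).

Definition star_invariant (R : realType) (m n : nat) (G : lie_group R n)
    (M : manifold R m) (w : symplectic_form M) (A : symplectic_action G w)
    (S : star_product w) : Prop :=
  forall (g : G) (u v : fseries M), fsmooth u -> fsmooth v -> forall r x,
    translate A g (star S u v) r x =
    star S (translate A g u) (translate A g v) r x.

(* (xi u)(x) = d/dt u(exp(-t xi) x) at t = 0, i.e. the value at the unit of the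
   left-invariant vector field xi applied to g |-> u(g^-1 x). *)
Definition infinitesimal (R : realType) (m n : nat) (G : lie_group R n)
    (M : manifold R m) (w : symplectic_form M) (A : symplectic_action G w)
    (X : lie_basis G) (xi : 'rV[R]_n) (u : M -> R[i]) : M -> R[i] :=
  fun x =>
    (lb_field X xi (fun g => complex.Re (u (act A (lg_inv g) x))) (lg_one G)
     +i* lb_field X xi (fun g => complex.Im (u (act A (lg_inv g) x)))
          (lg_one G))%C.

Definition bracket_lambda (R : realType) (n : nat)
    (br : 'rV[R]_n -> 'rV[R]_n -> 'rV[R]_n) (xi eta : nat -> 'rV[R]_n) :
  nat -> 'rV[R]_n :=
  fun r => \sum_(k < r) br (xi k) (eta (r.-1 - k)%N).

(* The enveloping algebra of g_lambda, with scalars extended to C[[lambda]], is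
   presented by generators and relations: it is the quotient of the type of
   expressions [uexpr] by the congruence [ueq]. *)
Inductive uexpr (R : realType) (n : nat) : Type :=
| UGen of nat -> 'rV[R]_n
| UCst of cseries R
| UAdd of uexpr R n & uexpr R n
| UMul of uexpr R n & uexpr R n.

Arguments UCst {R n} _.

Inductive ueq (R : realType) (n : nat)
    (br : 'rV[R]_n -> 'rV[R]_n -> 'rV[R]_n) :
    uexpr R n -> uexpr R n -> Prop :=
| ueq_refl p : ueq br p p
| ueq_sym p q : ueq br p q -> ueq br q p
| ueq_trans p q t : ueq br p q -> ueq br q t -> ueq br p t
| ueq_add p p' q q' : ueq br p p' -> ueq br q q' ->
    ueq br (UAdd p q) (UAdd p' q')
| ueq_mul p p' q q' : ueq br p p' -> ueq br q q' ->
    ueq br (UMul p q) (UMul p' q')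
| ueq_addA p q t : ueq br (UAdd p (UAdd q t)) (UAdd (UAdd p q) t)
| ueq_addC p q : ueq br (UAdd p q) (UAdd q p)
| ueq_mulA p q t : ueq br (UMul p (UMul q t)) (UMul (UMul p q) t)
| ueq_mulDl p q t : ueq br (UMul (UAdd p q) t) (UAdd (UMul p t) (UMul q t))
| ueq_mulDr p q t : ueq br (UMul t (UAdd p q)) (UAdd (UMul t p) (UMul t q))
| ueq_mul0 p : ueq br (UMul (UCst (cseries_cst 0)) p) (UCst (cseries_cst 0))
| ueq_add0 p : ueq br (UAdd (UCst (cseries_cst 0)) p) p
| ueq_mul1 p : ueq br (UMul (UCst (cseries_cst 1)) p) p
| ueq_cstC c p : ueq br (UMul (UCst c) p) (UMul p (UCst c))
| ueq_cstD c d :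
    ueq br (UAdd (UCst c) (UCst d)) (UCst (fun r => c r + d r))
| ueq_cstM c d : ueq br (UMul (UCst c) (UCst d)) (UCst (cseries_mul c d))
| ueq_genD xi eta :
    ueq br (UAdd (UGen xi) (UGen eta)) (UGen (fun r => xi r + eta r))
| ueq_genZ (c : nat -> R) xi :
    ueq br (UMul (UCst (fun r => (c r)%:C%C)) (UGen xi))
           (UGen (fun r => \sum_(k < r.+1) c k *: xi (r - k)%N))
| ueq_lie xi eta :
    ueq br (UMul (UGen xi) (UGen eta))
           (UAdd (UMul (UGen eta) (UGen xi))
                 (UGen (bracket_lambda br xi eta))).

Definition ugen (R : realType) (n : nat) (xi : 'rV[R]_n) : uexpr R n :=
  UGen (fun r => if r == 0%N then xi else 0).

Definition uscalar (R : realType) (n : nat) (c : R[i]) : uexpr R n :=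
  UCst (cseries_cst c).
Arguments uscalar {R n} c.

(* The average of the products X_{t(s 0)} ... X_{t(s (d-1))} over the
   permutations s of the positions of the word t. *)
Definition symmetrize_word (R : realType) (n : nat) (t : seq 'I_n) :
  uexpr R n :=
  UMul (uscalar ((size t)`!%:R^-1))
    (\big[@UAdd R n/uscalar 0]_(s : 'S_(size t))
      \big[@UMul R n/uscalar 1]_(k < size t)
        ugen (delta_mx 0 (tnth (in_tuple t) (s k)))).

Definition multinom_word (n : nat) (I : multinom n) : seq 'I_n :=
  flatten [seq nseq (I l) l | l <- enum 'I_n].

(* The symmetrization map s; the l-th variable of a polynomial is X_l, seen as
   the linear coordinate mu_l on g^*. *)
Definition symmetrize (R : realType) (n : nat) (u : mpoly n R[i]) :
  uexpr R n :=
  \big[@UAdd R n/uscalar 0]_(I <- msupp u)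
    UMul (uscalar (mcoeff I u)) (symmetrize_word R (multinom_word I)).

Record quantum_moment_map (R : realType) (m n : nat) (G : lie_group R n)
    (X : lie_basis G) (M : manifold R m) (w : symplectic_form M)
    (A : symplectic_action G w) (S : star_product w) : Type :=
  QuantumMomentMap {
  qm_map : uexpr R n -> fseries M;
  qm_smooth : forall p, fsmooth (qm_map p);
  qm_wd : forall p q, ueq (lb_bracket X) p q ->
    forall r x, qm_map p r x = qm_map q r x;
  qm_add : forall p q r x, qm_map (UAdd p q) r x = qm_map p r x + qm_map q r x;
  qm_scale : forall (c : cseries R) p r x,
    qm_map (UMul (UCst c) p) r x = fseries_scale c (qm_map p) r x;
  qm_one : forall r x,
    qm_map (uscalar 1) r x = fseries_cst (fun _ : M => 1) r x;
  qm_mul : forall p q r x,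
    qm_map (UMul p q) r x = star S (qm_map p) (qm_map q) r x;
  qm_moment : forall (xi : 'rV[R]_n) (u : fseries M), fsmooth u ->
    forall r x,
      star S (qm_map (ugen xi)) u r x - star S u (qm_map (ugen xi)) r x =
      if r is r'.+1 then infinitesimal A X xi (u r') x else 0
}.

(* The restriction of a quantum moment map to Pol(g^* ), through s. *)
Definition qm_pol (R : realType) (m n : nat) (G : lie_group R n)
    (X : lie_basis G) (M : manifold R m) (w : symplectic_form M)
    (A : symplectic_action G w) (S : star_product w)
    (Phi : quantum_moment_map X A S) (u : mpoly n R[i]) : fseries M :=
  qm_map Phi (symmetrize u).

Definition pol_fun (R : realType) (n : nat) (u : mpoly n R[i]) :
  'rV[R]_n -> R[i] := fun mu => meval (fun l => (mu 0 l)%:C%C) u.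

(* The classical part of Phi is composition with J : M -> g^*. *)
Definition classical_part (R : realType) (m n : nat) (G : lie_group R n)
    (X : lie_basis G) (M : manifold R m) (w : symplectic_form M)
    (A : symplectic_action G w) (S : star_product w)
    (Phi : quantum_moment_map X A S) (J : M -> 'rV[R]_n) : Prop :=
  forall (u : mpoly n R[i]) (x : M), qm_pol Phi u 0%N x = pol_fun u (J x).

Definition Dmu (R : realType) (n : nat) (I : multinom n)
    (u : 'rV[R]_n -> R[i]) : 'rV[R]_n -> R[i] :=
  fun mu => (- 'i%C) ^+ mdeg I * cderiv I u mu.

Definition coeff_smooth (R : realType) (m n : nat) (M : manifold R m)
    (s : multinom n -> nat -> M -> R[i]) : Prop :=
  forall I j, csmooth (s I j).

Definition locally_finite (R : realType) (m n : nat) (M : manifold R m)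
    (s : multinom n -> nat -> M -> R[i]) : Prop :=
  forall (j : nat) (x : M), exists N : nat,
    \forall z \near x, forall I, (N <= mdeg I)%N -> s I j z = 0.

(* f = \sum_j lambda^j \sum_I s_{I,j} (D^I u \o J), where the sum over I at a
   point x is truncated at any order N beyond which the s_{I,j}(x) vanish. *)
Definition expands_along (R : realType) (m n : nat) (M : manifold R m)
    (J : M -> 'rV[R]_n) (s : multinom n -> nat -> M -> R[i])
    (u : 'rV[R]_n -> R[i]) (f : fseries M) : Prop :=
  forall (j : nat) (x : M) (N : nat),
    (forall I, (N <= mdeg I)%N -> s I j x = 0) ->
    f j x = \sum_(I : bmultinom n N) s I j x * Dmu I u (J x).

Definition differentiable_qmm (R : realType) (m n : nat) (M : manifold R m)
    (J : M -> 'rV[R]_n) (T : mpoly n R[i] -> fseries M) : Prop :=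
  exists s : multinom n -> nat -> M -> R[i],
    [/\ coeff_smooth s, locally_finite s
      & forall u, expands_along J s (pol_fun u) (T u)].

Definition differentiable_extension (R : realType) (m n : nat)
    (M : manifold R m) (J : M -> 'rV[R]_n) (T : mpoly n R[i] -> fseries M)
    (Psi : ('rV[R]_n -> R[i]) -> fseries M) : Prop :=
  (forall u r x, Psi (pol_fun u) r x = T u r x) /\
  exists s : multinom n -> nat -> M -> R[i],
    [/\ coeff_smooth s, locally_finite s
      & forall u, csmooth_on setT u -> expands_along J s u (Psi u)].

(* [A r J] is the coefficient of lambda^r y^J. *)
Definition weyl (R : realType) (m : nat) : Type :=
  nat -> multinom m -> R[i].

Definition weyl_dy (R : realType) (m : nat) (i : 'I_m) (A : weyl R m) :
  weyl R m := fun r J => (J i).+1%:R * A r (mnm_add J (mnm1 i)).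

Definition weyl_y (R : realType) (m : nat) (i : 'I_m) (A : weyl R m) :
  weyl R m := fun r J => if J i == 0%N then 0 else A r (mnm_sub J (mnm1 i)).

Definition weyl_mul (R : realType) (m : nat) (P : 'M[R]_m) (A B : weyl R m) :
  weyl R m :=
  fun r J => \sum_(k < r.+1) \sum_(k1 < r.+1)
    \sum_(k2 < r.+1 | (k + k1 + k2 == r)%N)
      2^-1 ^+ k / k`!%:R *
      \sum_(I : k.-tuple 'I_m) \sum_(I' : k.-tuple 'I_m)
        (\prod_(t < k) (P (tnth I t) (tnth I' t))%:C%C) *
        \sum_(J1 : bmultinom m (mdeg J).+1)
          \sum_(J2 : bmultinom m (mdeg J).+1 | mnm_add J1 J2 == J)
            foldr (@weyl_dy R m) A I k1 J1 * foldr (@weyl_dy R m) B I' k2 J2.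

(* (1/lambda) [A, B]; the lambda^0 coefficient of [A, B] is zero. *)
Definition weyl_ad (R : realType) (m : nat) (P : 'M[R]_m) (A B : weyl R m) :
  weyl R m := fun r J => weyl_mul P A B r.+1 J - weyl_mul P B A r.+1 J.

(* The y-homogeneous component of degree d of the lambda^r coefficient, as a
   polynomial function on the tangent space. *)
Definition weyl_eval (R : realType) (m : nat) (A : weyl R m) (r d : nat)
    (v : 'rV[R]_m) : R[i] :=
  \sum_(J : bmultinom m d.+1 | mdeg J == d)
    A r J * \prod_(i < m) (v 0 i)%:C%C ^+ J i.

(* A section of W is given by its components in the charts. *)
Definition weyl_section (R : realType) (m : nat) (M : manifold R m)
    (s : idx M -> M -> weyl R m) : Prop :=
  (forall a r J, csmooth_in (dom a) (fun x => s a x r J)) /\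
  forall a b x, dom a x -> dom b x -> forall r d v,
    weyl_eval (s b x) r d v = weyl_eval (s a x) r d (v *m jac b a x).

Definition weyl_one_form (R : realType) (m : nat) (M : manifold R m)
    (s : idx M -> 'I_m -> M -> weyl R m) : Prop :=
  (forall a i r J, csmooth_in (dom a) (fun x => s a i x r J)) /\
  forall a b x, dom a x -> dom b x -> forall i r d v,
    weyl_eval (s b i x) r d v =
    \sum_(p < m) (jac b a x i p)%:C%C *
      weyl_eval (s a p x) r d (v *m jac b a x).

(* [christoffel a l k j] is Gamma^l_{kj} in the chart a. *)
Record symplectic_connection (R : realType) (m : nat) (M : manifold R m)
    (w : symplectic_form M) : Type := SymplecticConnection {
  christoffel : idx M -> 'I_m -> 'I_m -> 'I_m -> M -> R;
  chr_smooth : forall a l k j, smooth_in (dom a) (christoffel a l k j);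
  chr_law : forall a b x, dom a x -> dom b x -> forall p i j,
    \sum_(l < m) christoffel b l i j x * jac b a x l p =
    \sum_(q < m) \sum_(t < m)
      jac b a x i q * jac b a x j t * christoffel a p q t x +
    chart_partial b i (chart_partial b j (fun z => chart a z 0 p)) x;
  chr_torsion_free : forall a x, dom a x -> forall l k j,
    christoffel a l k j x = christoffel a l j k x;
  chr_symplectic : forall a x, dom a x -> forall k i j,
    chart_partial a k (fun z => omega w a z i j) x =
    \sum_(l < m) (christoffel a l k i x * omega w a x l j +
                  christoffel a l k j x * omega w a x i l)
}.

(* The covariant derivative along the k-th coordinate of the chart a. *)
Definition weyl_nabla (R : realType) (m : nat) (M : manifold R m)
    (w : symplectic_form M) (N : symplectic_connection w) (a : idx M)
    (k : 'I_m) (s : M -> weyl R m) : M -> weyl R m :=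
  fun x r J => chart_cpartial a k (fun z => s z r J) x -
    \sum_(l < m) \sum_(j < m) (christoffel N a l k j x)%:C%C *
      weyl_y j (weyl_dy l (s x)) r J.

(* R^p_{qkl} *)
Definition curvature (R : realType) (m : nat) (M : manifold R m)
    (w : symplectic_form M) (N : symplectic_connection w) (a : idx M)
    (p q k l : 'I_m) (x : M) : R :=
  chart_partial a k (christoffel N a p l q) x -
  chart_partial a l (christoffel N a p k q) x +
  \sum_(t < m) (christoffel N a p k t x * christoffel N a t l q x -
                christoffel N a p l t x * christoffel N a t k q x).

(* The component along dx^k /\ dx^l (k < l) of the Weyl curvature
     omega + R - delta gamma + partial gamma - (1/lambda) gamma o gamma
   of D, where omega = (1/2) omega_{kl} dx^k /\ dx^l and
   R = (1/4) omega_{pt} R^p_{qkl} y^t y^q dx^k /\ dx^l; thus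
   D^2 = -(1/lambda) [curvature, -]. *)
Definition weyl_curvature (R : realType) (m : nat) (M : manifold R m)
    (w : symplectic_form M) (N : symplectic_connection w)
    (gamma : idx M -> 'I_m -> M -> weyl R m) (a : idx M) (k l : 'I_m)
    (x : M) : weyl R m :=
  let one : weyl R m := fun r J => ((r == 0%N) && (J == mnm0))%:R in
  fun r J =>
    (omega w a x k l)%:C%C * one r J +
    2^-1 * (\sum_(p < m) \sum_(t < m) \sum_(q < m)
      (omega w a x p t * curvature N a p q k l x)%:C%C *
        weyl_y t (weyl_y q one) r J) -
    (weyl_dy k (gamma a l x) r J - weyl_dy l (gamma a k x) r J) +
    (weyl_nabla N a k (gamma a l) x r J -
     weyl_nabla N a l (gamma a k) x r J) -
    weyl_ad (omega_inv w a x) (gamma a k x) (gamma a l x) r J.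

(* D is Abelian: its Weyl curvature is a scalar 2-form. *)
Record fedosov_connection (R : realType) (m : nat) (M : manifold R m)
    (w : symplectic_form M) (N : symplectic_connection w) : Type :=
  FedosovConnection {
  fed_gamma : idx M -> 'I_m -> M -> weyl R m;
  fed_form : weyl_one_form fed_gamma;
  fed_degree : forall a x, dom a x -> forall i r J,
    (r.*2 + mdeg J < 3)%N -> fed_gamma a i x r J = 0;
  fed_abelian : forall a x, dom a x -> forall k l r J,
    J != mnm0 -> weyl_curvature N fed_gamma a k l x r J = 0
}.

(* The component along dx^k of D s in the chart a. *)
Definition fedosov_D (R : realType) (m : nat) (M : manifold R m)
    (w : symplectic_form M) (N : symplectic_connection w)
    (F : fedosov_connection N) (s : idx M -> M -> weyl R m) (a : idx M)
    (k : 'I_m) (x : M) : weyl R m :=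
  fun r J =>
    - weyl_dy k (s a x) r J + weyl_nabla N a k (s a) x r J -
    weyl_ad (omega_inv w a x) (fed_gamma F a k x) (s a x) r J.

(* s is an element of W_D. *)
Definition flat_section (R : realType) (m : nat) (M : manifold R m)
    (w : symplectic_form M) (N : symplectic_connection w)
    (F : fedosov_connection N) (s : idx M -> M -> weyl R m) : Prop :=
  weyl_section s /\
  forall a k x, dom a x -> forall r J, fedosov_D F s a k x r J = 0.

(* sigma(s) = u *)
Definition is_symbol (R : realType) (m : nat) (M : manifold R m)
    (s : idx M -> M -> weyl R m) (u : fseries M) : Prop :=
  forall a x, dom a x -> forall r, s a x r mnm0 = u r x.

Definition fedosov_type (R : realType) (m : nat) (M : manifold R m)
    (w : symplectic_form M) (S : star_product w) : Prop :=
  exists (N : symplectic_connection w) (F : fedosov_connection N)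
         (Q : fseries M -> idx M -> M -> weyl R m),
    [/\ forall u, fsmooth u -> flat_section F (Q u) /\ is_symbol (Q u) u,
        forall s u, flat_section F s -> fsmooth u -> is_symbol s u ->
          forall a x, dom a x -> forall r J, Q u a x r J = s a x r J
      & forall u v, fsmooth u -> fsmooth v ->
          is_symbol (fun a x => weyl_mul (omega_inv w a x) (Q u a x) (Q v a x))
            (star S u v)].

(* Main.v *)
(* Over a point x, expand in the monomials (mu - J(x))^I: the coefficient S_{I,j}
   can only be i^|I|/I! times the lambda^j-part at x of Phi_*((mu - J(x))^I), and
   everything reduces to the vanishing of that value for |I| large (|I| > 2j in
   the Fedosov case). By polarization (mu - J(x))^I may be replaced by the powers
   (t.(mu - J(x)))^d, and symmetrization maps these to d-fold star powers of
   Phi_*(t.X) - t.J(x), whose lambda^0-part vanishes at x. Give a function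
   vanishing to order d at x the weight d and give lambda the weight c. Such an
   element has weight 1, and if the star product respects the filtration by
   weight, its d-th power has weight d, so that the lambda^j-part vanishes at x
   as soon as d > c j.

   In orders up to j, any differential star product respects the filtration near
   a given point when c is at least the total order of C_1, ..., C_j. For one of
   Fedosov type c = 2 works: D Q(u) = 0 expresses each component of Q(u) through
   first derivatives of components of lower total degree 2r + |J|, so these
   components vanish to order d - 2r - |J| if u has weight d, and the Weyl
   product preserves the total degree. *)

From HB Require Import structures.
Require Import Defs.
From mathcomp Require Import all_boot all_order all_algebra fingroup perm.
From mathcomp Require Import all_classical all_reals all_analysis.
From mathcomp Require Import complex zify ring generic_quotient.
From mathcomp Require Import -(notations) mpoly.
From mathcomp Require ssrcomplements.
Set Implicit Arguments.
Unset Strict Implicit.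
Unset Printing Implicit Defensive.
Import Order.TTheory GRing.Theory Num.Theory.
Import numFieldNormedType.Exports.
Local Open Scope classical_set_scope.
Local Open Scope ring_scope.

(** * Smooth functions and order of vanishing *)

Section RealSmooth.
Context {R : realType} {m : nat}.
Variables (V : set 'rV[R]_m) (openV : open V).
Implicit Types (f g : 'rV[R]_m -> R) (y : 'rV[R]_m) (i : 'I_m) (k : nat).

Let base f := forall y, V y ->
  {for y, continuous f} /\ forall i, derivable f y (delta_mx 0 i).

(** Finite-order form of smoothness: the derivatives of order at most [k] are continuous and have
    partial derivatives again. The cut-off allows induction for products and inverses, whose
    derivatives are built from functions controlled to one order less. *)
Fixpoint smooth_upto k f : Prop :=
  if k is k'.+1 then base f /\ forall i, smooth_upto k' (partial i f)
  else base f.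

Lemma smooth_onP f : smooth_on V f <-> forall k, smooth_upto k f.
Proof.
split=> [sf k|sf s].
  elim: k f sf => [|k IH] f sf; first by move=> y Vy; exact: (sf [::] y Vy).
  split=> [y Vy|i]; first exact: (sf [::] y Vy).
  by apply: IH => s y Vy; have := sf (rcons s i) y Vy; rewrite foldr_rcons.
(* [smooth_upto] differentiates innermost first, so words are taken apart at their last letter. *)
elim/last_ind: s f sf => [|s i IH] f sf y Vy; first exact: (sf 0%N y Vy).
by rewrite foldr_rcons; apply: IH => // k; have [_] := sf k.+1; exact.
Qed.

(** Openness of [V] makes limits and derivatives at its points depend on the values in [V] alone;
    chart parametrizations are arbitrary elsewhere. *)
Lemma near_open f g y : (forall z, V z -> f z = g z) -> V y ->
  {near y, f =1 g}.
Proof.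
move=> fg Vy; have : nbhs y V by exact: open_nbhs_nbhs.
by apply: filterS => z /fg.
Qed.

Lemma eq_partial f g : (forall y, V y -> f y = g y) ->
  forall i y, V y -> partial i f y = partial i g y.
Proof. by move=> fg i y Vy; apply: near_eq_derive; exact: near_open. Qed.

Lemma eq_smooth_upto k f g : (forall y, V y -> f y = g y) ->
  smooth_upto k f -> smooth_upto k g.
Proof.
have eqb f' g' : (forall y, V y -> f' y = g' y) -> base f' -> base g'.
  move=> fg bf y Vy; have [cf df] := bf y Vy; have nfg := near_open fg Vy.
  split=> [|i]; last exact: near_eq_derivable (df i).
  rewrite /prop_for/continuous_at -(fg _ Vy).
  exact: cvg_trans (near_eq_cvg nfg) cf.
elim: k f g => [|k IH] f g fg /=; first exact: eqb.
case=> bf pf; split=> [|i]; first exact: eqb bf.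
by apply: IH (pf i); exact: eq_partial.
Qed.

Lemma eq_smooth_on f g : (forall y, V y -> f y = g y) ->
  smooth_on V f -> smooth_on V g.
Proof.
by move=> fg /smooth_onP sf; apply/smooth_onP => k; exact: eq_smooth_upto (sf k).
Qed.

Lemma smooth_upto_base k f : smooth_upto k f -> base f.
Proof. by case: k => [|k] //= []. Qed.

Lemma smooth_uptoW k f : smooth_upto k.+1 f -> smooth_upto k f.
Proof.
elim: k f => [|k IH] f /= [bf pf] //; split=> // i; exact: IH (pf i).
Qed.

Lemma smooth_on_partial i f : smooth_on V f -> smooth_on V (partial i f).
Proof. by move=> sf s y Vy; have := sf (rcons s i) y Vy; rewrite foldr_rcons. Qed.

Lemma smooth_on_derivable f y i : V y -> smooth_on V f ->
  derivable f y (delta_mx 0 i).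
Proof. by move=> Vy /(_ [::] y Vy)[]. Qed.

Lemma smooth_on_continuous f y : V y -> smooth_on V f -> {for y, continuous f}.
Proof. by move=> Vy /(_ [::] y Vy)[]. Qed.

Lemma partial_cst i (c : R) y : partial i (fun=> c) y = 0.
Proof. exact: derive_cst. Qed.

Lemma smooth_on_cst (c : R) : smooth_on V (fun=> c).
Proof.
apply/smooth_onP => k; elim: k c => [|k IH] c.
  by move=> y _; split=> [|i]; [exact: cst_continuous|exact: derivable_cst].
split=> [y _|i]; first by split=> [|i]; [exact: cst_continuous|exact: derivable_cst].
by apply: eq_smooth_upto (IH 0) => y _; rewrite partial_cst.
Qed.

Lemma partialD i f g y : derivable f y (delta_mx 0 i) ->
  derivable g y (delta_mx 0 i) ->
  partial i (fun z => f z + g z) y = partial i f y + partial i g y.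
Proof. exact: deriveD. Qed.

Lemma partialN i f y : derivable f y (delta_mx 0 i) ->
  partial i (fun z => - f z) y = - partial i f y.
Proof. exact: deriveN. Qed.

Lemma partialM i f g y : derivable f y (delta_mx 0 i) ->
  derivable g y (delta_mx 0 i) ->
  partial i (fun z => f z * g z) y = partial i f y * g y + f y * partial i g y.
Proof.
move=> df dg; rewrite /partial [LHS](deriveM df dg) addrC mulrC.
by congr (_ + _).
Qed.

Lemma smooth_upto_D k f g : smooth_upto k f -> smooth_upto k g ->
  smooth_upto k (fun y => f y + g y).
Proof.
have bD f' g' : base f' -> base g' -> base (fun y => f' y + g' y).
  move=> bf bg y Vy; have [cf df] := bf y Vy; have [cg dg] := bg y Vy.
  by split=> [|i]; [exact: continuousD|exact: derivableD].
elim: k f g => [|k IH] f g /=; first exact: bD.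
move=> [bf pf] [bg pg]; split=> [|i]; first exact: bD.
apply: eq_smooth_upto (IH _ _ (pf i) (pg i)) => y Vy.
by rewrite partialD //; [case: (bf y Vy)|case: (bg y Vy)].
Qed.

Lemma smooth_upto_M k f g : smooth_upto k f -> smooth_upto k g ->
  smooth_upto k (fun y => f y * g y).
Proof.
have bM f' g' : base f' -> base g' -> base (fun y => f' y * g' y).
  move=> bf bg y Vy; have [cf df] := bf y Vy; have [cg dg] := bg y Vy.
  by split=> [|i]; [exact: continuousM|exact: derivableM].
elim: k f g => [|k IH] f g /=; first exact: bM.
move=> sf sg; have [bf pf] := sf; have [bg pg] := sg.
split=> [|i]; first exact: bM.
apply: (@eq_smooth_upto _ (fun y => partial i f y * g y + f y * partial i g y)).
  by move=> y Vy; rewrite partialM //; [case: (bf y Vy)|case: (bg y Vy)].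
by apply: smooth_upto_D; apply: IH => //; exact: smooth_uptoW.
Qed.

Lemma smooth_onD f g : smooth_on V f -> smooth_on V g ->
  smooth_on V (fun y => f y + g y).
Proof.
by move=> /smooth_onP sf /smooth_onP sg; apply/smooth_onP => k; exact: smooth_upto_D.
Qed.

Lemma smooth_onM f g : smooth_on V f -> smooth_on V g ->
  smooth_on V (fun y => f y * g y).
Proof.
by move=> /smooth_onP sf /smooth_onP sg; apply/smooth_onP => k; exact: smooth_upto_M.
Qed.

Lemma smooth_onN f : smooth_on V f -> smooth_on V (fun y => - f y).
Proof.
move=> sf; apply: (@eq_smooth_on (fun y => -1 * f y)).
  by move=> y _; rewrite mulN1r.
exact: smooth_onM (smooth_on_cst _) sf.
Qed.

Lemma smooth_on_sum (I : Type) (r : seq I) (P : pred I)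
    (F : I -> 'rV[R]_m -> R) :
  (forall j, smooth_on V (F j)) ->
  smooth_on V (fun y => \sum_(j <- r | P j) F j y).
Proof.
move=> sF; elim: r => [|j r IH].
  by apply: eq_smooth_on (smooth_on_cst 0) => y _; rewrite big_nil.
apply: (@eq_smooth_on (fun y =>
    (if P j then F j y else 0) + \sum_(i <- r | P i) F i y)).
  by move=> y _; rewrite big_cons; case: ifP => // _; rewrite add0r.
apply: smooth_onD IH; case: (P j); [exact: sF|exact: smooth_on_cst].
Qed.

Lemma smooth_on_prod (I : Type) (r : seq I) (P : pred I)
    (F : I -> 'rV[R]_m -> R) :
  (forall j, smooth_on V (F j)) ->
  smooth_on V (fun y => \prod_(j <- r | P j) F j y).
Proof.
move=> sF; elim: r => [|j r IH].
  by apply: eq_smooth_on (smooth_on_cst 1) => y _; rewrite big_nil.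
apply: (@eq_smooth_on (fun y =>
    (if P j then F j y else 1) * \prod_(i <- r | P i) F i y)).
  by move=> y _; rewrite big_cons; case: ifP => // _; rewrite mul1r.
apply: smooth_onM IH; case: (P j); [exact: sF|exact: smooth_on_cst].
Qed.

(** The derivative [- f' / f^2] is a smooth function times two copies of [1/f], so the induction on
    the order closes on [1/f] itself. *)
Lemma smooth_onV f : (forall y, V y -> f y != 0) -> smooth_on V f ->
  smooth_on V (fun y => (f y)^-1).
Proof.
move=> f0 sf; apply/smooth_onP; elim=> [|k IH] /=.
  move=> y Vy; split=> [|i].
    by apply: continuousV; [exact: f0|exact: smooth_on_continuous].
  by apply: derivableV; [exact: f0|exact: smooth_on_derivable].
split=> [|i]; first exact: smooth_upto_base IH.
apply: (@eq_smooth_upto _ (fun y => - partial i f y * ((f y)^-1 * (f y)^-1))).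
  move=> y Vy; rewrite /partial deriveV ?f0 //; last exact: smooth_on_derivable.
  by rewrite /GRing.scale /= mulNr mulrC -invfM -expr2 mulNr.
have sp : smooth_on V (fun y => - partial i f y).
  by apply: smooth_onN; exact: smooth_on_partial.
by apply: smooth_upto_M; [exact: ((smooth_onP _).1 sp k)|exact: smooth_upto_M].
Qed.

Lemma partial_coord i j y : partial i (fun z => z 0 j) y = (i == j)%:R.
Proof.
have lin : linear (fun z : 'rV[R]_m => z 0 j) by move=> a u v; rewrite !mxE.
pose coordl : {linear 'rV[R]_m -> R} := HB.pack (fun z : 'rV[R]_m => z 0 j)
  (GRing.isLinear.Build _ _ _ _ _ lin).
rewrite /partial (_ : (fun z : 'rV[R]_m => z 0 j) = coordl) //.
have coordc : continuous coordl by exact: coord_continuous.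
rewrite deriveE; last exact: linear_differentiable.
by rewrite (diff_lin _ coordc) /= mxE eqxx eq_sym.
Qed.

Lemma smooth_on_coord j : smooth_on V (fun z => z 0 j).
Proof.
apply/smooth_onP => k.
have bc : base (fun z => z 0 j).
  move=> y _; split=> [|i]; first exact: coord_continuous.
  by apply: diff_derivable; exact: differentiable_coord.
case: k => [//|k]; split=> // i.
apply: (@eq_smooth_upto _ (fun=> (i == j)%:R)).
  by move=> y _; rewrite partial_coord.
exact: ((smooth_onP _).1 (smooth_on_cst _)).
Qed.

Lemma smooth_on_det p (F : 'rV[R]_m -> 'M[R]_p) :
  (forall a b, smooth_on V (fun y => F y a b)) ->
  smooth_on V (fun y => \det (F y)).
Proof.
move=> sF; apply: smooth_on_sum => s; apply: smooth_onM.
  exact: smooth_on_cst.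
by apply: smooth_on_prod => a; exact: sF.
Qed.

(** Cramer's formula. It serves for the Poisson tensor, the inverse of the matrix of [omega]. *)
Lemma smooth_on_invmx p (F : 'rV[R]_m -> 'M[R]_p) :
  (forall y, V y -> F y \in unitmx) ->
  (forall a b, smooth_on V (fun y => F y a b)) ->
  forall a b, smooth_on V (fun y => invmx (F y) a b).
Proof.
move=> uF sF a b.
apply: (@eq_smooth_on (fun y => (\det (F y))^-1 * cofactor (F y) b a)).
  by move=> y /uF uFy; rewrite /invmx uFy !mxE.
apply: smooth_onM.
  apply: smooth_onV; last exact: smooth_on_det.
  by move=> y /uF; rewrite unitmxE unitfE.
apply: smooth_onM; first exact: smooth_on_cst.
apply: smooth_on_det => c d.
by apply: eq_smooth_on (sF (lift b c) (lift a d)) => y _; rewrite !mxE.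
Qed.

End RealSmooth.

(** * Complex-valued functions and their order of vanishing at a point *)

Section ComplexSmooth.
Context {R : realType} {m : nat}.
Variables (V : set 'rV[R]_m) (openV : open V).
Implicit Types (u v : 'rV[R]_m -> R[i]) (y : 'rV[R]_m) (i : 'I_m) (k : nat).

Lemma ReM (a b : R[i]) :
  complex.Re (a * b) = complex.Re a * complex.Re b - complex.Im a * complex.Im b.
Proof. by case: a b => [? ?] [? ?]. Qed.

Lemma ImM (a b : R[i]) :
  complex.Im (a * b) = complex.Re a * complex.Im b + complex.Im a * complex.Re b.
Proof. by case: a b => [? ?] [? ?]. Qed.

Lemma ReD (a b : R[i]) : complex.Re (a + b) = complex.Re a + complex.Re b.
Proof. by case: a b => [? ?] [? ?]. Qed.

Lemma ImD (a b : R[i]) : complex.Im (a + b) = complex.Im a + complex.Im b.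
Proof. by case: a b => [? ?] [? ?]. Qed.

Lemma complexP (a b : R[i]) : complex.Re a = complex.Re b ->
  complex.Im a = complex.Im b -> a = b.
Proof. by case: a b => [? ?] [? ?] /= -> ->. Qed.

Lemma eq_csmooth_on u v : (forall y, V y -> u y = v y) ->
  csmooth_on V u -> csmooth_on V v.
Proof.
move=> uv [su tu]; split.
  by apply: (eq_smooth_on openV _ su) => y Vy; rewrite uv.
by apply: (eq_smooth_on openV _ tu) => y Vy; rewrite uv.
Qed.

Lemma csmooth_on_cst (c : R[i]) : csmooth_on V (fun=> c).
Proof. by split; exact: smooth_on_cst. Qed.

Lemma csmooth_on_real (f : 'rV[R]_m -> R) : smooth_on V f ->
  csmooth_on V (fun y => (f y)%:C%C).
Proof. by move=> sf; split; [exact: sf|exact: smooth_on_cst]. Qed.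

Lemma csmooth_onD u v : csmooth_on V u -> csmooth_on V v ->
  csmooth_on V (fun y => u y + v y).
Proof.
move=> [su tu] [sv tv]; split.
  by apply: (eq_smooth_on openV _ (smooth_onD openV su sv)) => y _; rewrite ReD.
by apply: (eq_smooth_on openV _ (smooth_onD openV tu tv)) => y _; rewrite ImD.
Qed.

Lemma csmooth_onM u v : csmooth_on V u -> csmooth_on V v ->
  csmooth_on V (fun y => u y * v y).
Proof.
move=> [su tu] [sv tv]; split.
  apply: (eq_smooth_on openV _ (smooth_onD openV (smooth_onM openV su sv)
    (smooth_onN openV (smooth_onM openV tu tv)))) => y _.
  by rewrite ReM.
apply: (eq_smooth_on openV _ (smooth_onD openV (smooth_onM openV su tv)
  (smooth_onM openV tu sv))) => y _.
by rewrite ImM.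
Qed.

Lemma csmooth_on_sum (I : Type) (r : seq I) (P : pred I)
    (F : I -> 'rV[R]_m -> R[i]) :
  (forall j, csmooth_on V (F j)) ->
  csmooth_on V (fun y => \sum_(j <- r | P j) F j y).
Proof.
move=> sF; elim: r => [|j r IH].
  by apply: eq_csmooth_on (csmooth_on_cst 0) => y _; rewrite big_nil.
apply: (@eq_csmooth_on (fun y =>
    (if P j then F j y else 0) + \sum_(i <- r | P i) F i y)).
  by move=> y _; rewrite big_cons; case: ifP => // _; rewrite add0r.
apply: csmooth_onD IH; case: (P j); [exact: sF|exact: csmooth_on_cst].
Qed.

Lemma csmooth_on_prod (I : Type) (r : seq I) (P : pred I)
    (F : I -> 'rV[R]_m -> R[i]) :
  (forall j, csmooth_on V (F j)) ->
  csmooth_on V (fun y => \prod_(j <- r | P j) F j y).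
Proof.
move=> sF; elim: r => [|j r IH].
  by apply: eq_csmooth_on (csmooth_on_cst 1) => y _; rewrite big_nil.
apply: (@eq_csmooth_on (fun y =>
    (if P j then F j y else 1) * \prod_(i <- r | P i) F i y)).
  by move=> y _; rewrite big_cons; case: ifP => // _; rewrite mul1r.
apply: csmooth_onM IH; case: (P j); [exact: sF|exact: csmooth_on_cst].
Qed.

Lemma csmooth_on_cpartial i u : csmooth_on V u -> csmooth_on V (cpartial i u).
Proof. by move=> [su tu]; split; exact: smooth_on_partial. Qed.

Lemma eq_cpartial u v : (forall y, V y -> u y = v y) ->
  forall i y, V y -> cpartial i u y = cpartial i v y.
Proof.
move=> uv i y Vy; rewrite /cpartial; congr (_ +i* _)%C.
  by apply: (eq_partial openV) => // z Vz; rewrite uv.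
by apply: (eq_partial openV) => // z Vz; rewrite uv.
Qed.

Lemma cpartial_cst i (c : R[i]) y : cpartial i (fun=> c) y = 0.
Proof. by rewrite /cpartial !partial_cst. Qed.

Lemma cpartialD i u v y : V y -> csmooth_on V u -> csmooth_on V v ->
  cpartial i (fun z => u z + v z) y = cpartial i u y + cpartial i v y.
Proof.
move=> Vy [su tu] [sv tv]; have d f := @smooth_on_derivable R m V f y i Vy.
apply: complexP => /=.
  rewrite -(partialD (d _ su) (d _ sv)).
  by apply: (eq_partial openV) => // z _; rewrite ReD.
rewrite -(partialD (d _ tu) (d _ tv)).
by apply: (eq_partial openV) => // z _; rewrite ImD.
Qed.

Lemma cpartialM i u v y : V y -> csmooth_on V u -> csmooth_on V v ->
  cpartial i (fun z => u z * v z) y =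
  cpartial i u y * v y + u y * cpartial i v y.
Proof.
move=> Vy [su tu] [sv tv]; have d f := @smooth_on_derivable R m V f y i Vy.
apply: complexP.
  rewrite ReD !ReM /= (eq_partial openV (g := fun z =>
    complex.Re (u z) * complex.Re (v z) +
    - (complex.Im (u z) * complex.Im (v z)))) //; last first.
    by move=> z _; rewrite ReM.
  rewrite partialD; last 2 first.
  - exact: d (smooth_onM openV su sv).
  - exact: d (smooth_onN openV (smooth_onM openV tu tv)).
  rewrite partialN; last exact: d (smooth_onM openV tu tv).
  rewrite (partialM (d _ su) (d _ sv)) (partialM (d _ tu) (d _ tv)).
  by ring.
rewrite ImD !ImM /= (eq_partial openV (g := fun z =>
  complex.Re (u z) * complex.Im (v z) +
  complex.Im (u z) * complex.Re (v z))) //; last first.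
  by move=> z _; rewrite ImM.
rewrite partialD; last 2 first.
- exact: d (smooth_onM openV su tv).
- exact: d (smooth_onM openV tu sv).
rewrite (partialM (d _ su) (d _ tv)) (partialM (d _ tu) (d _ sv)).
by ring.
Qed.

(** The derivatives involved are those along all words of fewer than [k] coordinate directions;
    order [0] is no condition. *)
Fixpoint vanishes k u y : Prop :=
  if k is k'.+1 then u y = 0 /\ forall i, vanishes k' (cpartial i u) y else True.

Lemma eq_vanishes k u v y : (forall z, V z -> u z = v z) -> V y ->
  vanishes k u y -> vanishes k v y.
Proof.
elim: k u v => [//|k IH] u v uv Vy [u0 pu]; split; first by rewrite -uv.
by move=> i; apply: IH (pu i) => //; exact: eq_cpartial.
Qed.

Lemma vanishes_le k k' u y : (k <= k')%N -> vanishes k' u y -> vanishes k u y.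
Proof.
elim: k' k u => [|k' IH] [|k] u //; rewrite ltnS => kk' [u0 pu]; split=> // i.
exact: IH (pu i).
Qed.

Lemma vanishes0 k y : vanishes k (fun=> 0) y.
Proof.
(* The derivative of the zero function is zero only up to a proved equality, so the induction runs
   over all functions equal to it. *)
suff: forall u, u = (fun=> 0) -> vanishes k u y by apply.
elim: k => [//|k IH] u u0 /=; split=> [|i]; first by rewrite u0.
by apply: IH; apply/funext => z; rewrite u0 cpartial_cst.
Qed.

Lemma vanishesD k u v y : V y -> csmooth_on V u -> csmooth_on V v ->
  vanishes k u y -> vanishes k v y -> vanishes k (fun z => u z + v z) y.
Proof.
move=> Vy; elim: k u v => [//|k IH] u v su sv [u0 pu] [v0 pv].
split=> [|i]; first by rewrite u0 v0 addr0.
apply: (eq_vanishes (u := fun z => cpartial i u z + cpartial i v z) _ Vy).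
  by move=> z Vz; rewrite cpartialD.
exact: IH (csmooth_on_cpartial i su) (csmooth_on_cpartial i sv) (pu i) (pv i).
Qed.

(** Leibniz rule: a derivative takes one order of vanishing off one factor. As [k] is only bounded
    by [a + b], the truncated predecessors [a.-1] and [b.-1] are harmless. *)
Lemma vanishesM a b k u v y : (k <= a + b)%N -> V y ->
  csmooth_on V u -> csmooth_on V v ->
  vanishes a u y -> vanishes b v y -> vanishes k (fun z => u z * v z) y.
Proof.
move=> kab Vy; elim: k a b u v kab => [//|k IH] a b u v kab su sv va vb.
split=> [|i].
  case: a kab va => [|a] kab va; last by case: va => u0 _; rewrite u0 mul0r.
  by case: b kab vb => [//|b] kab [v0 _]; rewrite v0 mulr0.
apply: (eq_vanishes _ Vy
  (u := fun z => cpartial i u z * v z + u z * cpartial i v z)).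
  by move=> z Vz; rewrite cpartialM.
have su' := csmooth_on_cpartial i su; have sv' := csmooth_on_cpartial i sv.
apply: (vanishesD Vy (csmooth_onM su' sv) (csmooth_onM su sv')).
  apply: (IH a.-1 b _ _ _ su' sv _ vb); first by lia.
  by case: a {kab} va => [//|a] [_]; exact.
apply: (IH a b.-1 _ _ _ su sv' va); first by lia.
by case: b {kab} vb => [//|b] [_]; exact.
Qed.

Lemma vanishesMl k u v y : V y -> csmooth_on V u -> csmooth_on V v ->
  vanishes k v y -> vanishes k (fun z => u z * v z) y.
Proof. by move=> Vy su sv; exact: (vanishesM (leqnn (0 + k)) Vy su sv I). Qed.

Lemma vanishes_sum k (I : Type) (r : seq I) (P : pred I)
    (F : I -> 'rV[R]_m -> R[i]) y :
  V y -> (forall j, csmooth_on V (F j)) ->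
  (forall j, P j -> vanishes k (F j) y) ->
  vanishes k (fun z => \sum_(j <- r | P j) F j z) y.
Proof.
move=> Vy sF vF; elim: r => [|j r IH].
  by apply: (eq_vanishes _ Vy (vanishes0 k y)) => z _; rewrite big_nil.
have [Pj|nPj] := boolP (P j); last first.
  by apply: (eq_vanishes _ Vy IH) => z _; rewrite big_cons (negbTE nPj).
have vD := vanishesD Vy (sF j) (csmooth_on_sum r P sF) (vF j Pj) IH.
by apply: (eq_vanishes _ Vy vD) => z _; rewrite big_cons Pj.
Qed.

Lemma vanishes_cpartial k i u y :
  vanishes k u y -> vanishes k.-1 (cpartial i u) y.
Proof. by case: k => [//|k] [_ pu]; exact: pu. Qed.

Lemma csmooth_on_cderiv (I : multinom m) u :
  csmooth_on V u -> csmooth_on V (cderiv I u).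
Proof.
rewrite /cderiv; elim: (enum _) => [//|i s IH] su /=.
elim: (I i) => [|k IHk] /=; first exact: IH.
exact: csmooth_on_cpartial.
Qed.

Lemma vanishes_cderiv k (I : multinom m) u y :
  vanishes k u y -> vanishes (k - mdeg I) (cderiv I u) y.
Proof.
move=> vu; rewrite /cderiv mdegE -big_enum /=.
elim: (enum _) => [|i s IH] /=; first by rewrite big_nil subn0.
rewrite big_cons; elim: (I i) => [|l IHl] /=; first by rewrite add0n.
apply: vanishes_le (vanishes_cpartial i IHl).
by lia.
Qed.

End ComplexSmooth.
Arguments csmooth_on_cderiv {R m V} I {u} _.
Arguments vanishes_cderiv {R m k} I {u y} _.
Arguments csmooth_on_sum {R m V} openV {I} r P {F} _.
Arguments vanishes_sum {R m V} openV {k I r P F y} _ _ _.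

(** * The enveloping algebra as a ring and the symmetrization map *)

Section EnvelopingAlgebra.
Context {R : realType} {n : nat}.
Variable br : 'rV[R]_n -> 'rV[R]_n -> 'rV[R]_n.

Definition uexpr_of (_ : 'rV[R]_n -> 'rV[R]_n -> 'rV[R]_n) := uexpr R n.
HB.instance Definition _ := gen_eqMixin (uexpr_of br).
HB.instance Definition _ := gen_choiceMixin (uexpr_of br).

Definition ueqb (p q : uexpr_of br) : bool := `[< ueq br p q >].

Lemma ueqb_refl : reflexive ueqb.
Proof. by move=> p; apply/asboolP/ueq_refl. Qed.

Lemma ueqb_sym : ssrbool.symmetric ueqb.
Proof. by move=> p q; apply/asboolP/asboolP => /ueq_sym. Qed.

Lemma ueqb_trans : transitive ueqb.
Proof. by move=> q p t /asboolP pq /asboolP qt; apply/asboolP/(ueq_trans pq). Qed.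

Canonical ueqb_equiv := EquivRel ueqb ueqb_refl ueqb_sym ueqb_trans.

(** As a ring, the quotient makes iterated sums and products and the binomial formula available for
    the symmetrization map. *)
Definition envelope := {eq_quot ueqb_equiv}%qT.
HB.instance Definition _ := Choice.on envelope.

Definition ucl (p : uexpr R n) : envelope := \pi_({eq_quot ueqb_equiv}%qT)%qT p.
Definition urep (a : envelope) : uexpr R n := repr a.

Lemma urepK a : ucl (urep a) = a.
Proof. exact: reprK. Qed.

Lemma uclP p q : ucl p = ucl q <-> ueq br p q.
Proof.
split=> [/eqP|pq]; first by rewrite eqmodE => /asboolP.
by apply/eqP; rewrite eqmodE; apply/asboolP.
Qed.

Lemma urep_ucl p : ueq br (urep (ucl p)) p.
Proof. by apply/uclP; rewrite urepK. Qed.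

Definition env_add (a b : envelope) : envelope := ucl (UAdd (urep a) (urep b)).
Definition env_mul (a b : envelope) : envelope := ucl (UMul (urep a) (urep b)).
Definition env_cst (c : R[i]) : envelope := ucl (uscalar c).
(** The presentation has no negation; the constant [-1] supplies it. *)
Definition env_opp (a : envelope) : envelope := env_mul (env_cst (-1)) a.

Lemma env_addE p q : env_add (ucl p) (ucl q) = ucl (UAdd p q).
Proof. by apply/uclP; apply: ueq_add; exact: urep_ucl. Qed.

Lemma env_mulE p q : env_mul (ucl p) (ucl q) = ucl (UMul p q).
Proof. by apply/uclP; apply: ueq_mul; exact: urep_ucl. Qed.

Lemma env_ind (P : envelope -> Prop) : (forall p, P (ucl p)) -> forall a, P a.
Proof. by move=> Pp a; rewrite -(urepK a). Qed.

Lemma env_cst_add c d : env_add (env_cst c) (env_cst d) = env_cst (c + d).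
Proof.
rewrite env_addE; apply/uclP; apply: ueq_trans (ueq_cstD _ _ _) _.
rewrite (_ : (fun r => _) = cseries_cst (c + d)); first exact: ueq_refl.
by apply/funext => r; rewrite /cseries_cst; case: eqP; rewrite ?addr0.
Qed.

Lemma cseries_mul_cst (c d : R[i]) :
  cseries_mul (cseries_cst c) (cseries_cst d) = cseries_cst (c * d).
Proof.
apply/funext => r; rewrite /cseries_mul big_ord_recl /= subn0 /cseries_cst /=.
rewrite big1 ?addr0; last by move=> k _; rewrite /= mul0r.
by case: eqP; rewrite ?mulr0.
Qed.

Lemma env_cst_mul c d : env_mul (env_cst c) (env_cst d) = env_cst (c * d).
Proof.
rewrite env_mulE; apply/uclP; apply: ueq_trans (ueq_cstM _ _ _) _.
by rewrite cseries_mul_cst; exact: ueq_refl.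
Qed.

Lemma env_cst_comm c a : env_mul (env_cst c) a = env_mul a (env_cst c).
Proof.
by elim/env_ind: a => p; rewrite !env_mulE; apply/uclP; exact: ueq_cstC.
Qed.

Lemma env_addA : associative env_add.
Proof.
elim/env_ind => p; elim/env_ind => q; elim/env_ind => t.
by rewrite !env_addE; apply/uclP; exact: ueq_addA.
Qed.

Lemma env_addC : commutative env_add.
Proof.
elim/env_ind => p; elim/env_ind => q.
by rewrite !env_addE; apply/uclP; exact: ueq_addC.
Qed.

Lemma env_add0 : left_id (env_cst 0) env_add.
Proof. by elim/env_ind => p; rewrite env_addE; apply/uclP; exact: ueq_add0. Qed.

Lemma env_mulA : associative env_mul.
Proof.
elim/env_ind => p; elim/env_ind => q; elim/env_ind => t.
by rewrite !env_mulE; apply/uclP; exact: ueq_mulA.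
Qed.

Lemma env_mul1 : left_id (env_cst 1) env_mul.
Proof. by elim/env_ind => p; rewrite env_mulE; apply/uclP; exact: ueq_mul1. Qed.

Lemma env_mulr1 : right_id (env_cst 1) env_mul.
Proof. by move=> a; rewrite -env_cst_comm env_mul1. Qed.

Lemma env_mulDl : left_distributive env_mul env_add.
Proof.
elim/env_ind => p; elim/env_ind => q; elim/env_ind => t.
rewrite env_addE !env_mulE env_addE; apply/uclP; exact: ueq_mulDl.
Qed.

Lemma env_mulDr : right_distributive env_mul env_add.
Proof.
elim/env_ind => p; elim/env_ind => q; elim/env_ind => t.
rewrite env_addE !env_mulE env_addE; apply/uclP; exact: ueq_mulDr.
Qed.

Lemma env_addN : left_inverse (env_cst 0) env_opp env_add.
Proof.
move=> a; rewrite -[X in env_add _ X]env_mul1 -env_mulDl env_cst_add addNr.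
by elim/env_ind: a => p; rewrite env_mulE; apply/uclP; exact: ueq_mul0.
Qed.

HB.instance Definition _ := GRing.isPzRing.Build envelope
  env_addA env_addC env_add0 env_addN env_mulA env_mul1 env_mulr1
  env_mulDl env_mulDr.

Lemma uclD p q : ucl (UAdd p q) = ucl p + ucl q.
Proof. by rewrite -env_addE. Qed.

Lemma uclM p q : ucl (UMul p q) = ucl p * ucl q.
Proof. by rewrite -env_mulE. Qed.

Lemma env_cst_is_additive : zmod_morphism env_cst.
Proof.
move=> c d; apply: (addIr (env_cst d)); rewrite subrK.
by rewrite -[LHS]/(env_add _ _) env_cst_add subrK.
Qed.

Lemma env_cst_is_multiplicative : monoid_morphism env_cst.
Proof. by split=> // c d; rewrite -env_cst_mul. Qed.

HB.instance Definition _ := GRing.isZmodMorphism.Build R[i] envelope env_cst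
  env_cst_is_additive.
HB.instance Definition _ := GRing.isMonoidMorphism.Build R[i] envelope env_cst
  env_cst_is_multiplicative.

Lemma env_cstC c a : env_cst c * a = a * env_cst c.
Proof. exact: env_cst_comm. Qed.

Lemma ucl_sum (I : Type) (r : seq I) (P : pred I) (F : I -> uexpr R n) :
  ucl (\big[@UAdd R n/uscalar 0]_(j <- r | P j) F j) =
  \sum_(j <- r | P j) ucl (F j).
Proof. exact: (big_morph ucl uclD). Qed.

Lemma ucl_prod (I : Type) (r : seq I) (P : pred I) (F : I -> uexpr R n) :
  ucl (\big[@UMul R n/uscalar 1]_(j <- r | P j) F j) =
  \prod_(j <- r | P j) ucl (F j).
Proof. exact: (big_morph ucl uclM). Qed.

End EnvelopingAlgebra.

Lemma count_multinom_word n (I : multinom n) (l : 'I_n) :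
  count_mem l (multinom_word I) = I l.
Proof.
rewrite /multinom_word count_flatten -map_comp sumnE big_map.
rewrite (bigD1_seq l) ?mem_enum ?enum_uniq //=.
rewrite count_nseq /= eqxx mul1n big1 ?addn0 // => l' ne.
by rewrite count_nseq /= (negbTE ne).
Qed.

Lemma size_multinom_word n (I : multinom n) : size (multinom_word I) = mdeg I.
Proof.
rewrite /multinom_word size_flatten sumnE /shape -map_comp big_map mdegE.
by rewrite -big_enum; apply: eq_bigr => l _; rewrite /= size_nseq.
Qed.

Section Symmetrization.
Context {R : realType} {n : nat}.
Variable br : 'rV[R]_n -> 'rV[R]_n -> 'rV[R]_n.
Local Notation env := (envelope br).
Local Notation cst := (env_cst br).
Local Notation X l := (mpolyX R[i] (mnm1 l)).

Definition env_gen (l : 'I_n) : env := ucl br (ugen (delta_mx 0 l)).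

Definition env_word (t : seq 'I_n) : env := ucl br (symmetrize_word R t).

Definition env_sym (u : mpoly n R[i]) : env := ucl br (symmetrize u).

Lemma env_wordE d (t : d.-tuple 'I_n) :
  env_word t = cst (d`!%:R^-1) *
    \sum_(s : 'S_d) \prod_(k < d) env_gen (tnth t (s k)).
Proof.
case: t => t sz; have dE := eqP sz; move: sz; rewrite -{}dE => sz /=.
rewrite /env_word /symmetrize_word uclM ucl_sum; congr (_ * _).
apply: eq_bigr => s _; rewrite ucl_prod; apply: eq_bigr => k _.
rewrite /env_gen; congr (ucl br (ugen (delta_mx 0 _))).
have x0 := tnth (in_tuple t) k.
by rewrite [LHS](tnth_nth x0) [RHS](tnth_nth x0).
Qed.

(** Translation in the symmetric group by the permutation relating the two words only reorders the
    summands. *)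
Lemma env_word_perm d (t t' : d.-tuple 'I_n) :
  perm_eq t t' -> env_word t = env_word t'.
Proof.
case/tuple_permP => p tp; rewrite !env_wordE; congr (_ * _).
have tE k : tnth t k = tnth t' (p k).
  rewrite (_ : t = [tuple tnth t' (p i) | i < d]) ?tnth_mktuple //.
  exact: val_inj.
rewrite [RHS](reindex_inj (mulIg p)); apply: eq_bigr => s _.
by apply: eq_bigr => k _; rewrite tE permM.
Qed.

Lemma env_symE u :
  env_sym u = \sum_(I <- msupp u) cst (mcoeff I u) * env_word (multinom_word I).
Proof.
by rewrite /env_sym ucl_sum; apply: eq_bigr => I _; rewrite uclM.
Qed.

(** With an index set independent of the support, polynomials of different supports can be compared
    term by term. *)
Lemma env_symwE k u : (msize u <= k)%N -> env_sym u =
  \sum_(I : bmultinom n k) cst (mcoeff I u) * env_word (multinom_word I).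
Proof.
move=> uk; pose P (I : bmultinom n k) := val I \in msupp u.
rewrite (bigID P) {}/P /= addrC big1 ?add0r; last first.
  by move=> I /memN_msupp_eq0 ->; rewrite raddf0 mul0r.
rewrite env_symE (ssrcomplements.big_mksub (bmultinom n k)) //=.
  exact: msupp_uniq.
by move=> I /msize_mdeg_lt /leq_trans; apply.
Qed.

Lemma env_symD u v : env_sym (u + v) = env_sym u + env_sym v.
Proof.
pose k := maxn (msize u) (msize v).
have ku : (msize u <= k)%N by rewrite leq_maxl.
have kv : (msize v <= k)%N by rewrite leq_maxr.
rewrite (env_symwE (leq_trans (msizeD_le u v) (leqnn k))) (env_symwE ku).
rewrite (env_symwE kv) -big_split; apply: eq_bigr => I _.
by rewrite mcoeffD raddfD mulrDl.
Qed.

Lemma env_symZ c u : env_sym (c *: u) = cst c * env_sym u.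
Proof.
rewrite (env_symwE (msizeZ_le u c)) (env_symwE (leqnn _)) mulr_sumr.
by apply: eq_bigr => I _; rewrite mcoeffZ rmorphM mulrA.
Qed.

Lemma env_sym_sum (T : Type) (r : seq T) (P : pred T) (F : T -> mpoly n R[i]) :
  env_sym (\sum_(j <- r | P j) F j) = \sum_(j <- r | P j) env_sym (F j).
Proof.
apply: (big_morph _ env_symD).
by rewrite env_symE msupp0 big_nil.
Qed.

Lemma env_symX I : env_sym (mpolyX R[i] I) = env_word (multinom_word I).
Proof. by rewrite env_symE msuppX big_seq1 mcoeffX eqxx rmorph1 mul1r. Qed.

Lemma env_prod_cst d (c : 'I_d -> R[i]) (a : 'I_d -> env) :
  \prod_(k < d) (cst (c k) * a k) = cst (\prod_(k < d) c k) * \prod_(k < d) a k.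
Proof.
elim: d c a => [|d IH] c a; first by rewrite !big_ord0 rmorph1 mul1r.
rewrite !big_ord_recl IH rmorphM -!mulrA; congr (_ * _).
by rewrite mulrA -env_cstC !mulrA.
Qed.

(* Averaging over the orderings has no effect on a power, whose expansion into
   words is already invariant under permutation of the letters. *)
Lemma env_sym_exp (t : 'I_n -> R[i]) d :
  env_sym ((\sum_l t l *: X l) ^+ d) = (\sum_l cst (t l) * env_gen l) ^+ d.
Proof.
have pE (A : pzRingType) (a : A) : a ^+ d = \prod_(k < d) a.
  by rewrite prodr_const card_ord.
rewrite !pE !bigA_distr_bigA /= env_sym_sum.
have monE (f : {ffun 'I_d -> 'I_n}) : \prod_(k < d) (t (f k) *: X (f k)) =
    (\prod_(k < d) t (f k)) *:
      mpolyX R[i] (\big[@mnm_add n/mnm0]_(k < d) mnm1 (f k)).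
  by rewrite scaler_prod (big_morph _ (@mpolyXD n _) (mpolyX0 n _)).
(* The word of a monomial lists its letters in sorted order; it is a rearrangement of [f] and so has
   the same symmetrization. *)
have wE (f : {ffun 'I_d -> 'I_n}) :
    env_word (multinom_word (\big[@mnm_add n/mnm0]_(k < d) mnm1 (f k))) =
    cst (d`!%:R^-1) * \sum_(s : 'S_d) \prod_(k < d) env_gen (f (s k)).
  set I := \big[_/_]_(_ < _) _.
  have szI : size (multinom_word I) == d.
    rewrite size_multinom_word mdeg_sum (eq_bigr (fun=> 1%N)).
      by rewrite sum1_card card_ord.
    by move=> k _; rewrite mdeg1.
  rewrite -[multinom_word I]/(val (Tuple szI)).
  rewrite (@env_word_perm _ _ [tuple f k | k < d]); last first.
    apply/allP => l _ /=; rewrite count_multinom_word /I mnm_sumE.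
    rewrite count_map -sum1_count big_enum_cond /= [Z in _ == Z]big_mkcond /=.
    by apply/eqP/eq_bigr => k _; rewrite mnm1E /=; case: eqP.
  rewrite env_wordE; congr (_ * _); apply: eq_bigr => s _.
  by apply: eq_bigr => k _; rewrite tnth_mktuple.
transitivity (\sum_(f : {ffun 'I_d -> 'I_n}) cst (d`!%:R^-1) *
    \sum_(s : 'S_d)
      cst (\prod_(k < d) t (f k)) * \prod_(k < d) env_gen (f (s k))).
  apply: eq_bigr => f _; rewrite monE env_symZ env_symX wE.
  by rewrite mulrA -env_cstC -mulrA mulr_sumr.
rewrite -mulr_sumr exchange_big /=.
pose y : env :=
  \sum_(f : {ffun 'I_d -> 'I_n}) \prod_k (cst (t (f k)) * env_gen (f k)).
(* For fixed [s], substituting [f \o s] for [f] shows that the inner sum is [y]; the [d!] equal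
   summands cancel the factor [1/d!]. *)
rewrite (eq_bigr (fun=> y)); last first.
  move=> s _; rewrite /y.
  rewrite [RHS](reindex_inj
    (h := fun f : {ffun 'I_d -> 'I_n} => [ffun k => f (s k)])).
    apply: eq_bigr => f _; rewrite env_prod_cst; congr (cst _ * _).
      rewrite (reindex_inj (@perm_inj _ s)); apply: eq_bigr => k _.
      by rewrite ffunE.
    by apply: eq_bigr => k _; rewrite ffunE.
  move=> f g /ffunP fg; apply/ffunP => k.
  by have := fg ((s^-1)%g k); rewrite !ffunE permKV.
rewrite sumr_const card_Sn mulrnAr -mulrnAl -raddfMn /=.
rewrite -[_ *+ _]mulr_natr mulVf.
  by rewrite rmorph1 mul1r.
by rewrite pnatr_eq0 -lt0n fact_gt0.
Qed.

(** Constants are central, so both powers expand by the binomial formula and the case without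
    constant applies to each term. *)
Lemma env_sym_shift_exp (t : 'I_n -> R[i]) c d :
  env_sym ((\sum_l t l *: X l + mpolyC n c) ^+ d) =
  (\sum_l cst (t l) * env_gen l + cst c) ^+ d.
Proof.
rewrite exprDn exprDn_comm; last by rewrite /GRing.comm env_cstC.
rewrite env_sym_sum; apply: eq_bigr => i _.
have -> : ((\sum_l t l *: X l) ^+ (d - i) * mpolyC n c ^+ i) *+ 'C(d, i)
    = (c ^+ i *+ 'C(d, i)) *: (\sum_l t l *: X l) ^+ (d - i).
  by rewrite -scalerMnl -mul_mpolyC rmorphXn mulrC.
by rewrite env_symZ env_sym_exp -rmorphXn /= -env_cstC raddfMn mulrnAl.
Qed.

End Symmetrization.

(** * Polarization and Taylor expansion of polynomials *)

Section Polarization.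
Context {R : realType} {n : nat}.
Local Notation X l := (mpolyX R[i] (mnm1 l)).

(** The natural numbers below [size p] are already too many roots. *)
Lemma poly_real_roots_eq0 (p : {poly R[i]}) :
  (forall s : R, p.[s%:C%C] = 0) -> p = 0.
Proof.
move=> p0; apply/eqP; apply/negPn/negP => pn0.
pose rs := [seq (k%:R : R[i]) | k <- iota 0 (size p)].
have /(max_poly_roots pn0) : all (root p) rs.
  apply/allP => _ /mapP[k _ ->]; rewrite /root -(p0 k%:R).
  by rewrite rmorph_nat.
rewrite map_inj_uniq ?iota_uniq => [/(_ isT)|i j /eqP]; last first.
  by rewrite eqr_nat => /eqP.
by rewrite size_map size_iota ltnn.
Qed.

Variable L : mpoly n R[i] -> R[i].
Hypothesis linL : forall c u v, L (c *: u + v) = c * L u + L v.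

Lemma lin_mpoly0 : L 0 = 0.
Proof.
have := linL 1 0 0; rewrite scale1r addr0 mul1r => /eqP.
by rewrite -subr_eq0 opprD addNKr oppr_eq0 => /eqP.
Qed.

Lemma lin_mpolyZ c u : L (c *: u) = c * L u.
Proof. by have := linL c u 0; rewrite !addr0 lin_mpoly0 addr0. Qed.

Lemma lin_mpolyD u v : L (u + v) = L u + L v.
Proof. by rewrite -[u in LHS]scale1r linL mul1r. Qed.

Lemma lin_mpoly_sum (T : Type) (r : seq T) (P : pred T) (F : T -> mpoly n R[i]) :
  L (\sum_(j <- r | P j) F j) = \sum_(j <- r | P j) L (F j).
Proof. exact: (big_morph L lin_mpolyD lin_mpoly0). Qed.

(** The factors of the power of a linear form are traded one at a time for variables, by varying the
    form in the direction of the variable and taking the linear coefficient. *)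
Lemma polarization d :
  (forall t : 'I_n -> R, L ((\sum_l (t l)%:C%C *: X l) ^+ d) = 0) ->
  forall I : multinom n, mdeg I = d -> L (mpolyX R[i] I) = 0.
Proof.
move=> L0 I Id.
have pol w e (t : 'I_n -> R) : (size w + e)%N = d ->
    L ((\sum_l (t l)%:C%C *: X l) ^+ e * \prod_(l <- w) X l) = 0.
  elim: w e t => [|l w IH] e t; first by rewrite add0n big_nil mulr1 => ->.
  rewrite /= addSnnS => /IH{}IH; rewrite big_cons.
  set a := \sum_l _; set W := \prod_(_ <- w) _ in IH *.
  (* This is [L] of [(a + s X_l)^(e+1) W] as a polynomial in [s]. The induction hypothesis, for the
     form with [t l] raised by [s], makes it vanish at every real [s]. *)
  pose p := \poly_(i < e.+2) L ((a ^+ (e.+1 - i) * X l ^+ i) *+ 'C(e.+1, i) * W).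
  have p0 : p = 0.
    apply: poly_real_roots_eq0 => s.
    rewrite /p horner_poly -[RHS](IH (fun k => t k + s * (k == l)%:R)).
    have -> : \sum_k (t k + s * (k == l)%:R)%:C%C *: X k = a + s%:C%C *: X l.
      rewrite (eq_bigr (fun k =>
        (t k)%:C%C *: X k + (s * (k == l)%:R)%:C%C *: X k)).
        rewrite big_split /=; congr (_ + _); rewrite (bigD1 l) //= eqxx mulr1.
        rewrite big1 ?addr0 // => k /negbTE ->.
        by rewrite mulr0 rmorph0 scale0r.
      by move=> k _; rewrite rmorphD scalerDl.
    rewrite exprDn mulr_suml lin_mpoly_sum; apply: eq_bigr => i _.
    rewrite mulrC -lin_mpolyZ; congr L.
    by rewrite exprZn -scalerAr scalerMnr -scalerAl.
  (* The linear coefficient is [e + 1] times the value wanted. *)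
  have : p`_1 = 0 by rewrite p0 coef0.
  rewrite coef_poly /= subn1 bin1 expr1 -mulr_natl -mulrA mulr_natl.
  rewrite -scaler_nat lin_mpolyZ => /eqP.
  by rewrite mulf_eq0 pnatr_eq0 /= mulrA => /eqP.
have := pol (multinom_word I) 0%N (fun=> 0).
rewrite size_multinom_word addn0 => /(_ Id); rewrite expr0 mul1r.
rewrite /multinom_word big_flatten big_map big_enum /= => <-; congr L.
rewrite mpolyXE_id; apply: eq_bigr => l _.
by rewrite big_nseq iter_mulr_1.
Qed.

End Polarization.

(** * Translation of polynomials by a constant vector *)

Section Shift.
Context {R : comNzRingType} {n : nat}.
Local Notation X l := (mpolyX R (mnm1 l)).

Definition shift_mpoly (c : 'I_n -> R) : mpoly n R -> mpoly n R :=
  comp_mpoly [tuple X l + mpolyC n (c l) | l < n].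

Lemma shift_mpolyX c l : shift_mpoly c (X l) = X l + mpolyC n (c l).
Proof. by rewrite /shift_mpoly comp_mpolyXU -tnth_nth tnth_mktuple. Qed.

Lemma shift_mpolyD c p q :
  shift_mpoly c (p + q) = shift_mpoly c p + shift_mpoly c q.
Proof. exact: comp_mpolyD. Qed.

Lemma shift_mpolyM c p q :
  shift_mpoly c (p * q) = shift_mpoly c p * shift_mpoly c q.
Proof. exact: rmorphM. Qed.

Lemma shift_mpolyZ c a p : shift_mpoly c (a *: p) = a *: shift_mpoly c p.
Proof. exact: comp_mpolyZ. Qed.

Lemma shift_mpolyC c a : shift_mpoly c (mpolyC n a) = mpolyC n a.
Proof. exact: comp_mpolyC. Qed.

Lemma shift_mpoly0 c : shift_mpoly c 0 = 0.
Proof. exact: comp_mpoly0. Qed.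

Lemma shift_mpoly1 c : shift_mpoly c 1 = 1.
Proof. exact: comp_mpoly1. Qed.

(** Constants and variables generate the polynomial ring, so identities between morphisms or
    derivations need checking only there. *)
Lemma mpoly_ring_ind (P : mpoly n R -> Prop) :
  (forall c, P (mpolyC n c)) -> (forall l, P (X l)) ->
  (forall p q, P p -> P q -> P (p + q)) ->
  (forall p q, P p -> P q -> P (p * q)) -> forall p, P p.
Proof.
move=> PC PX PD PM p; rewrite (mpolyE p).
apply: (big_ind P); [by rewrite -(mpolyC0 n); exact: PC|exact: PD|].
move=> I _; rewrite -mul_mpolyC; apply: (PM) => //; rewrite mpolyXE_id.
apply: (big_ind P); [by rewrite -(mpolyC1 n); exact: PC|exact: PM|].
move=> l _; elim: (I l) => [|k IH].
  by rewrite expr0 -(mpolyC1 n); exact: PC.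
by rewrite exprS; exact: PM.
Qed.

Lemma shift_mpolyK c : cancel (shift_mpoly (fun l => - c l)) (shift_mpoly c).
Proof.
elim/mpoly_ring_ind => [a|l|p q IHp IHq|p q IHp IHq].
- by rewrite !shift_mpolyC.
- by rewrite shift_mpolyX shift_mpolyD shift_mpolyX shift_mpolyC mpolyCN addrK.
- by rewrite !shift_mpolyD IHp IHq.
- by rewrite !shift_mpolyM IHp IHq.
Qed.

Lemma mderiv_shift c i p :
  mderiv i (shift_mpoly c p) = shift_mpoly c (mderiv i p).
Proof.
elim/mpoly_ring_ind: p => [a|l|p q IHp IHq|p q IHp IHq].
- by rewrite shift_mpolyC !mderivC shift_mpoly0.
- rewrite shift_mpolyX mderivD mderivC addr0 mderivX mnm1E.
  case: eqP => [->|_]; last by rewrite !scale0r shift_mpoly0.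
  have -> : mnm_sub (mnm1 i) (mnm1 i) = mnm0.
    by rewrite -{1}(add0m (mnm1 i)) addmK.
  by rewrite !scale1r mpolyX0 shift_mpoly1.
- by rewrite shift_mpolyD !mderivD IHp IHq shift_mpolyD.
- by rewrite shift_mpolyM !mderivM IHp IHq shift_mpolyD !shift_mpolyM.
Qed.

Lemma mderivm_shift c I p :
  mderivm I (shift_mpoly c p) = shift_mpoly c (mderivm I p).
Proof.
rewrite /mderivm; elim: (enum _) => [//|i s IH] /=; rewrite IH.
by elim: (I i) => [//|k IHk] /=; rewrite IHk mderiv_shift.
Qed.

Lemma meval_shift c v p :
  meval v (shift_mpoly c p) = meval (fun l => v l + c l) p.
Proof.
elim/mpoly_ring_ind: p => [a|l|p q IHp IHq|p q IHp IHq].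
- by rewrite shift_mpolyC !mevalC.
- by rewrite shift_mpolyX mevalD !mevalXU mevalC.
- by rewrite shift_mpolyD !mevalD IHp IHq.
- by rewrite shift_mpolyM !mevalM IHp IHq.
Qed.

End Shift.

(** * Taylor coefficients of a linear functional on polynomials *)

Section PolynomialFunctions.
Context {R : realType} {n : nat}.
Local Notation X l := (mpolyX R[i] (mnm1 l)).
Implicit Types (p q : mpoly n R[i]) (I : multinom n) (c : 'rV[R]_n).

Lemma pol_funD p q c : pol_fun (p + q) c = pol_fun p c + pol_fun q c.
Proof. exact: mevalD. Qed.

Lemma pol_funM p q c : pol_fun (p * q) c = pol_fun p c * pol_fun q c.
Proof. exact: mevalM. Qed.

Lemma pol_funC a c : pol_fun (mpolyC n a) c = a.
Proof. exact: mevalC. Qed.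

Lemma pol_funX l c : pol_fun (X l) c = (c 0 l)%:C%C.
Proof. exact: mevalXU. Qed.

Lemma csmooth_pol_fun p : csmooth_on setT (pol_fun p).
Proof.
elim/(@mpoly_ring_ind R[i] n): p => [a|l|p q IHp IHq|p q IHp IHq].
- apply: (eq_csmooth_on openT _ (csmooth_on_cst openT a)) => c _.
  by rewrite pol_funC.
- apply: (eq_csmooth_on openT _ (csmooth_on_real openT (smooth_on_coord openT l))).
  by move=> c _; rewrite pol_funX.
- apply: (eq_csmooth_on openT _ (csmooth_onD openT IHp IHq)) => c _.
  by rewrite pol_funD.
- apply: (eq_csmooth_on openT _ (csmooth_onM openT IHp IHq)) => c _.
  by rewrite pol_funM.
Qed.

(** Analytic and formal derivative both obey the Leibniz rule and agree on constants and
    variables. *)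
Lemma cpartial_pol_fun i p : cpartial i (pol_fun p) = pol_fun (mderiv i p).
Proof.
apply/funext => c; elim/(@mpoly_ring_ind R[i] n): p => [a|l|p q IHp IHq|p q IHp IHq].
- rewrite mderivC -(mpolyC0 n) pol_funC; apply: etrans (cpartial_cst i a c).
  by apply: (eq_cpartial openT) => [z _|]; rewrite ?pol_funC.
- rewrite mderivX mnm1E; apply: (@etrans _ _ ((l == i)%:R)).
    apply: (@etrans _ _ (cpartial i (fun z : 'rV[R]_n => (z 0 l)%:C%C) c)).
      by apply: (eq_cpartial openT) => [z _|]; rewrite ?pol_funX.
    rewrite /cpartial /= partial_coord partial_cst eq_sym.
    by case: eqP.
  case: eqP => [->|_]; last by rewrite scale0r -(mpolyC0 n) pol_funC.
  have -> : mnm_sub (mnm1 i) (mnm1 i) = mnm0.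
    by rewrite -{1}(add0m (mnm1 i)) addmK.
  by rewrite scale1r mpolyX0 -(mpolyC1 n) pol_funC.
- rewrite mderivD pol_funD -IHp -IHq -(cpartialD openT) //;
    try exact: csmooth_pol_fun.
  by apply: (eq_cpartial openT) => [z _|]; rewrite ?pol_funD.
- rewrite mderivM pol_funD !pol_funM -IHp -IHq -(cpartialM openT) //;
    try exact: csmooth_pol_fun.
  by apply: (eq_cpartial openT) => [z _|]; rewrite ?pol_funM.
Qed.

Lemma cderiv_pol_fun I p : cderiv I (pol_fun p) = pol_fun (mderivm I p).
Proof.
rewrite /cderiv /mderivm; elim: (enum _) => [//|i s IH] /=; rewrite IH.
by elim: (I i) => [//|k IHk] /=; rewrite IHk cpartial_pol_fun.
Qed.

Lemma meval_mcoeff0 p : meval (fun=> 0) p = mcoeff mnm0 p.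
Proof.
elim/(@mpoly_ring_ind R[i] n): p => [a|l|p q IHp IHq|p q IHp IHq].
- by rewrite mevalC mcoeffC eqxx mulr1.
- rewrite mevalXU mcoeffX; case: eqP => // /(congr1 mdeg).
  by rewrite mdeg1 mdeg0.
- by rewrite mevalD mcoeffD IHp IHq.
- by rewrite mevalM rmorphM IHp IHq.
Qed.

(** The polynomial [p(mu - c)]; on monomials it gives the basis [(mu - c)^I] of the Taylor expansion
    at [c]. *)
Definition recenter c (p : mpoly n R[i]) : mpoly n R[i] :=
  shift_mpoly (fun l => - (c 0 l)%:C%C) p.

Definition mnm_fact I : nat := \prod_(l < n) (I l)`!.

(** Differentiation commutes with translation, and evaluation at [c] becomes evaluation at [0],
    which reads off a coefficient of [p]. *)
Lemma Dmu_recenter c p I :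
  Dmu I (pol_fun (recenter c p)) c =
  (- 'i%C) ^+ mdeg I * ((mnm_fact I)%:R * mcoeff I p).
Proof.
rewrite /Dmu cderiv_pol_fun /recenter mderivm_shift; congr (_ * _).
rewrite /pol_fun meval_shift (meval_eq (v2 := fun=> 0)); last first.
  by move=> l /=; rewrite subrr.
rewrite meval_mcoeff0 mcoeff_mderivm addm0 mulr_natl; congr (_ *+ _).
by apply: eq_bigr => l _; rewrite ffactnn.
Qed.

Lemma recenter_surj c p : exists q, p = recenter c q.
Proof.
exists (shift_mpoly (fun l => - - (c 0 l)%:C%C) p).
by rewrite /recenter shift_mpolyK.
Qed.

Lemma recenter_linear c a p q :
  recenter c (a *: p + q) = a *: recenter c p + recenter c q.
Proof. by rewrite /recenter shift_mpolyD shift_mpolyZ. Qed.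

(* The only possible coefficients of an expansion of [L] at [c]: evaluate both
   sides on the monomials in [mu - c]. *)
Definition taylor_coeff c (L : mpoly n R[i] -> R[i]) I : R[i] :=
  'i%C ^+ mdeg I / (mnm_fact I)%:R * L (recenter c (mpolyX R[i] I)).

Lemma mnm_fact_neq0 I : (mnm_fact I)%:R != 0 :> R[i].
Proof.
rewrite pnatr_eq0 -lt0n; apply: prodn_gt0 => l; exact: fact_gt0.
Qed.

Lemma taylor_coeff_eq0 c L I :
  L (recenter c (mpolyX R[i] I)) = 0 -> taylor_coeff c L I = 0.
Proof. by rewrite /taylor_coeff => ->; rewrite mulr0. Qed.

Lemma iNi_exp k : ('i%C : R[i]) ^+ k * (- 'i%C) ^+ k = 1.
Proof. by rewrite -exprMn mulrN -expr2 sqr_i opprK expr1n. Qed.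

(** The factor [i^|I| / I!] of a Taylor coefficient is inverse to the factor [(-i)^|I| I!] produced
    by the derivative. *)
Lemma taylor_cancel I (a b : R[i]) :
  'i%C ^+ mdeg I / (mnm_fact I)%:R * a *
    ((- 'i%C) ^+ mdeg I * ((mnm_fact I)%:R * b)) = b * a.
Proof.
transitivity ('i%C ^+ mdeg I * (- 'i%C) ^+ mdeg I * (b * a)); last first.
  by rewrite iNi_exp mul1r.
move: ('i%C ^+ _) ((- 'i%C) ^+ _) => z z'.
by move: (_%:R) (mnm_fact_neq0 I) => k k0; field.
Qed.

Section Linear.
Variables (c : 'rV[R]_n) (L : mpoly n R[i] -> R[i]).
Hypothesis linL : forall a u v, L (a *: u + v) = a * L u + L v.

Lemma linL_recenter a u v :
  L (recenter c (a *: u + v)) = a * L (recenter c u) + L (recenter c v).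
Proof. by rewrite recenter_linear linL. Qed.

(** Every polynomial is a finite combination of the [(mu - c)^I], on which both sides agree. *)
Lemma taylor_expansion N :
  (forall I, (N <= mdeg I)%N -> taylor_coeff c L I = 0) ->
  forall p, L p =
    \sum_(I : bmultinom n N) taylor_coeff c L I * Dmu I (pol_fun p) c.
Proof.
move=> s0 p; have [q ->] := recenter_surj c p.
pose g I := mcoeff I q * L (recenter c (mpolyX R[i] I)).
have gE I : taylor_coeff c L I * Dmu I (pol_fun (recenter c q)) c = g I.
  by rewrite Dmu_recenter taylor_cancel.
have g0 I : (N <= mdeg I)%N -> g I = 0.
  by move=> /s0 sI; rewrite -gE sI mul0r.
rewrite (eq_bigr (fun I : bmultinom n N => g I)); last by move=> I _; exact: gE.
transitivity (\sum_(I <- msupp q) g I).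
  rewrite {1}(mpolyE q) (lin_mpoly_sum (L := fun u => L (recenter c u))).
    apply: eq_bigr => I _.
    by rewrite (lin_mpolyZ (L := fun u => L (recenter c u)) linL_recenter).
  exact: linL_recenter.
(* Both sums reduce to the exponents of degree below [N] in the support of [q]; all others
   contribute zero. *)
rewrite (bigID (fun I => (mdeg I < N)%N)) /= [Z in _ + Z]big1 ?addr0; last first.
  by move=> I; rewrite -leqNgt => /g0.
rewrite (ssrcomplements.big_mksub_cond (bmultinom n N)) ?msupp_uniq //=.
rewrite [RHS](bigID (fun I : bmultinom n N => val I \in msupp q)) /=.
rewrite [Z in _ = _ + Z]big1 ?addr0; last first.
  by move=> I /memN_msupp_eq0 qI; rewrite /g qI mul0r.
by apply: eq_bigl => I; rewrite bmdeg.
Qed.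

(** Testing the expansion on [(mu - c)^I] leaves the single term [I], or none if [|I| >= N], where
    [s I] is zero too. *)
Lemma taylor_unique N (s : multinom n -> R[i]) :
  (forall I, (N <= mdeg I)%N -> s I = 0) ->
  (forall p, L p = \sum_(I : bmultinom n N) s I * Dmu I (pol_fun p) c) ->
  forall I, s I = taylor_coeff c L I.
Proof.
move=> s0 Ls I; rewrite /taylor_coeff Ls.
have zero (I' : bmultinom n N) : val I' != I ->
    s I' * Dmu I' (pol_fun (recenter c (mpolyX R[i] I))) c = 0.
  by move=> ne; rewrite Dmu_recenter mcoeffX eq_sym (negbTE ne) !mulr0.
have [NI|IN] := leqP N (mdeg I).
  rewrite s0 // big1 ?mulr0 // => I' _; apply: zero.
  by apply: contraTneq NI => <-; rewrite -ltnNge bmdeg.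
rewrite (bigD1 (BMultinom IN)) //= big1 ?addr0; last first.
  by move=> I' ne; exact: zero.
by rewrite Dmu_recenter mcoeffX eqxx mulrA taylor_cancel mul1r.
Qed.

End Linear.
End PolynomialFunctions.

(** * Filtrations by order of vanishing *)

Section Charts.
Context {R : realType} {m : nat} {M : manifold R m}.
Implicit Types (a : idx M) (V : set M) (u v : M -> R[i]) (x : M).

Definition chart_image a V : set 'rV[R]_m := chart a @` (dom a `&` V).

Lemma chart_imageP a V y : chart_image a V y ->
  [/\ dom a (param a y), V (param a y) & chart a (param a y) = y].
Proof. by case=> x [ax Vx] <-; rewrite mf_chartK. Qed.

Lemma mem_chart_image a V x : dom a x -> V x -> chart_image a V (chart a x).
Proof. by move=> ax Vx; exists x. Qed.

(** Inside the open image of [dom a] the set is the preimage of [V] under [param a], which is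
    continuous there. *)
Lemma open_chart_image a V : open V -> open (chart_image a V).
Proof.
move=> oV; rewrite openE => y [x [ax Vx] xy].
have nU : nbhs y (chart a @` dom a).
  by apply: open_nbhs_nbhs; split; [exact: mf_img_open|exists x].
have nV : nbhs y (param a @^-1` V).
  rewrite -xy; apply: (mf_param_cont ax).
  by rewrite mf_chartK //; apply: open_nbhs_nbhs.
apply: filterS (filterI nU nV) => z [[x' ax' <-]].
by rewrite /preimage /= mf_chartK // => Vx'; exists x'.
Qed.

Arguments open_chart_image a {V} _.

Lemma chart_image_sub a V V' : V `<=` V' -> chart_image a V `<=` chart_image a V'.
Proof. by move=> VV' _ [x [ax /VV' Vx] <-]; exists x. Qed.

Lemma csmooth_on_sub (W W' : set 'rV[R]_m) (u : 'rV[R]_m -> R[i]) :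
  W `<=` W' -> csmooth_on W' u -> csmooth_on W u.
Proof. by move=> WW' [su tu]; split=> s y /WW' Wy; [exact: su|exact: tu]. Qed.

Lemma csmooth_inP V u :
  csmooth_in V u <-> forall a, csmooth_on (chart_image a V) (u \o param a).
Proof.
split=> [[su tu] a|su]; first by split; [exact: su|exact: tu].
by split=> a; [exact: (su a).1|exact: (su a).2].
Qed.

Lemma csmooth_chart a V u :
  csmooth u -> csmooth_on (chart_image a V) (u \o param a).
Proof.
move=> /csmooth_inP /(_ a); apply: csmooth_on_sub; exact: chart_image_sub.
Qed.

Lemma eq_csmooth u v : u =1 v -> csmooth u -> csmooth v.
Proof. by move=> /funext ->. Qed.

Lemma csmooth_cst (c : R[i]) : csmooth (fun _ : M => c).
Proof.
apply/csmooth_inP => a.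
by have := csmooth_on_cst (open_chart_image a openT) c; exact.
Qed.

Lemma csmoothD u v : csmooth u -> csmooth v -> csmooth (fun x => u x + v x).
Proof.
move=> /csmooth_inP su /csmooth_inP sv; apply/csmooth_inP => a.
by have := csmooth_onD (open_chart_image a openT) (su a) (sv a); exact.
Qed.

Lemma csmoothM u v : csmooth u -> csmooth v -> csmooth (fun x => u x * v x).
Proof.
move=> /csmooth_inP su /csmooth_inP sv; apply/csmooth_inP => a.
by have := csmooth_onM (open_chart_image a openT) (su a) (sv a); exact.
Qed.

End Charts.
Arguments open_chart_image {R m M} a {V} _.
Arguments csmooth_chart {R m M} a V {u} _.

(** * The filtration for a general differential star product *)

Section StarOrder.
Context {R : realType} {m : nat} {M : manifold R m} {w : symplectic_form M}.
Variable S : star_product w.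
Implicit Types (a : idx M) (f g : fseries M) (K : nat -> Prop).

(** [K] selects the powers of [lambda] considered: one [c] for all of them is established for
    Fedosov type, otherwise only one for the powers up to a given order. Subtraction is truncated,
    so powers with [c r >= d] are unconstrained. *)
Definition filtered a K c d (y : 'rV[R]_m) f : Prop :=
  forall r, K r -> vanishes (d - c * r) (f r \o param a) y.

(* The star product respects the filtration in which a function vanishing to
   order [d] has weight [d] and [lambda] has weight [c]. *)
Definition star_order a K c (y : 'rV[R]_m) : Prop :=
  forall d e f g, fsmooth f -> fsmooth g ->
    filtered a K c d y f -> filtered a K c e y g ->
    filtered a K c (d + e) y (star S f g).

(** The loss is measured as [N k], to be compared with the weight of [lambda^k]; for [k = 0], the
    pointwise product, it is zero. *)
Let cochain_order a k N (V : set M) : Prop := forall u v,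
  csmooth u -> csmooth v ->
  csmooth_on (chart_image a V) (sp_C S k u v \o param a) /\
  forall y, chart_image a V y -> forall d e,
    vanishes d (u \o param a) y -> vanishes e (v \o param a) y ->
    vanishes (d + e - N * k) (sp_C S k u v \o param a) y.

Lemma cochain_order_le a k N N' (V V' : set M) : (N <= N')%N -> V' `<=` V ->
  cochain_order a k N V -> cochain_order a k N' V'.
Proof.
move=> NN' VV' oV u v su sv; have [s o] := oV u v su sv; split.
  exact: csmooth_on_sub (chart_image_sub VV') s.
move=> y /(chart_image_sub VV') Vy d e vu vv.
apply: vanishes_le (o y Vy d e vu vv).
by rewrite leq_sub2l // leq_mul2r NN' orbT.
Qed.

Lemma cochain_order_ex a k x : dom a x ->
  exists (V : set M) (N : nat),
    [/\ open V, V x, V `<=` dom a & cochain_order a k N V].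
Proof.
move=> ax; case: k => [|k].
  exists (dom a), 0%N; split=> //; first exact: mf_open.
  have oU := open_chart_image a (mf_open a).
  move=> u v su sv; have su' := csmooth_chart a (dom a) su.
  have sv' := csmooth_chart a (dom a) sv.
  have eqC y : chart_image a (dom a) y ->
      (u \o param a) y * (v \o param a) y = (sp_C S 0 u v \o param a) y.
    by move=> _ /=; rewrite sp_C0.
  split=> [|y Vy d e vu vv].
    exact: eq_csmooth_on oU _ _ eqC (csmooth_onM oU su' sv').
  rewrite muln0 subn0; apply: (eq_vanishes oU eqC Vy).
  exact: vanishesM oU _ _ _ _ _ _ (leqnn _) Vy su' sv' vu vv.
have [V [N [c [oV Vx Va sc Cuv]]]] := sp_bidiff S (ltn0Sn k) ax.
(* Each argument is differentiated fewer than [N] times, so at most [2N] orders are lost, and the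
   index of the cochain is at least 1. *)
exists V, (N + N)%N; split=> //.
have oW := open_chart_image a oV; set W := chart_image a V in oW.
move=> u v su sv; have su' := csmooth_chart a V su.
have sv' := csmooth_chart a V sv.
pose F I J y : R[i] := (c I J \o param a) y * cderiv I (u \o param a) y *
  cderiv J (v \o param a) y.
have sc' I J : csmooth_on W (c I J \o param a) := (csmooth_inP _ _).1 (sc I J) a.
have su'' I := csmooth_on_cderiv I su'.
have sv'' I := csmooth_on_cderiv I sv'.
have sF I J : csmooth_on W (F I J) :=
  csmooth_onM oW (csmooth_onM oW (sc' I J) (su'' I)) (sv'' J).
have sG (I : bmultinom m N) :
    csmooth_on W (fun y => \sum_(J : bmultinom m N) F I J y) :=
  csmooth_on_sum oW _ _ (fun J : bmultinom m N => sF I J).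
pose G y : R[i] := \sum_(I : bmultinom m N) \sum_(J : bmultinom m N) F I J y.
have eqG y : W y -> G y = (sp_C S k.+1 u v \o param a) y.
  move=> Wy; have [ay Vy cy] := chart_imageP Wy.
  by rewrite /= (Cuv _ _ su sv _ Vy) /chart_cderiv cy.
split=> [|y Wy d e vu vv].
  exact: (eq_csmooth_on oW eqG (csmooth_on_sum oW _ _ sG)).
apply: (eq_vanishes oW eqG Wy); rewrite /G; apply: (vanishes_sum oW Wy sG) => I _.
apply: (vanishes_sum oW Wy (fun J : bmultinom m N => sF I J)) => J _.
have vI := vanishes_cderiv I vu; have vJ := vanishes_cderiv J vv.
have vcI := vanishesMl oW Wy (sc' I J) (su'' I) vI.
apply: (vanishesM oW _ Wy (csmooth_onM oW (sc' I J) (su'' I)) (sv'' J) vcI vJ).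
have := bmdeg I; have := bmdeg J; rewrite mulnS.
by move: (_ * k)%N; lia.
Qed.

Lemma cochain_order_upto a j x : dom a x ->
  exists (V : set M) (N : nat), [/\ open V, V x, V `<=` dom a
    & forall k, (k <= j)%N -> cochain_order a k N V].
Proof.
move=> ax; elim: j => [|j [V [N [oV Vx Va oN]]]].
  have [V [N [oV Vx Va o]]] := cochain_order_ex 0 ax.
  by exists V, N; split=> // k; rewrite leqn0 => /eqP ->.
have [V' [N' [oV' Vx' Va' o']]] := cochain_order_ex j.+1 ax.
exists (V `&` V'), (maxn N N'); split.
- exact: openI.
- by [].
- by move=> z [/Va].
move=> k; rewrite leq_eqVlt ltnS => /orP[/eqP ->|/oN].
  by apply: cochain_order_le o'; [rewrite leq_maxr|move=> z []].
by apply: cochain_order_le; [rewrite leq_maxl|move=> z []].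
Qed.

(** A term of order [r] combines [C_k], [f i] and [g l] with [k + i + l = r]; [C_k] costs at most
    [N k] orders of vanishing, which the weight [c k] of [lambda^k] covers for [c = N + 1]. The
    successor makes [c] positive. *)
Lemma star_order_near a j x : dom a x ->
  exists (V : set M) (c : nat), [/\ open V, V x, V `<=` dom a, (0 < c)%N
    & forall z, V z -> star_order a (fun r => (r <= j)%N) c (chart a z)].
Proof.
move=> ax; have [V [N [oV Vx Va oN]]] := cochain_order_upto j ax.
exists V, N.+1; split=> // z Vz d e f g sf sg vf vg r rj.
have oW := open_chart_image a oV.
have Wz : chart_image a V (chart a z) by apply: mem_chart_image => //; exact: Va.
have sC (k i l : 'I_r.+1) :
    csmooth_on (chart_image a V)
      (fun y => 2^-1 ^+ k * sp_C S k (f i) (g l) (param a y)).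
  apply: (csmooth_onM oW); first exact: csmooth_on_cst.
  by have [] := oN k (leq_trans (leq_ord k) rj) _ _ (sf i) (sg l).
apply: (vanishes_sum oW Wz) => [k|k _].
  apply: (csmooth_on_sum oW) => i; apply: (csmooth_on_sum oW) => l; exact: sC.
apply: (vanishes_sum oW Wz) => [i|i _].
  apply: (csmooth_on_sum oW) => l; exact: sC.
apply: (vanishes_sum oW Wz) => [l|l /eqP kil]; first exact: sC.
have kj := leq_trans (leq_ord k) rj.
have [s o] := oN k kj _ _ (sf i) (sg l).
apply: (vanishesMl oW Wz (csmooth_on_cst oW _) s).
have vi := vf i (leq_trans (leq_ord i) rj).
have vl := vg l (leq_trans (leq_ord l) rj).
apply: vanishes_le (o _ Wz _ _ vi vl).
move/(congr1 (muln N.+1)): kil; rewrite !mulnDr (mulSn N k) => <-.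
by move: (N * k)%N (N.+1 * i)%N (N.+1 * l)%N; lia.
Qed.

End StarOrder.

(** * Quantum moment maps *)

Section QuantumMomentMap.
Context {R : realType} {m n : nat} {G : lie_group R n} {X : lie_basis G}.
Context {M : manifold R m} {w : symplectic_form M} {A : symplectic_action G w}.
Context {S : star_product w} (Phi : quantum_moment_map X A S).
Local Notation env := (envelope (lb_bracket X)).
Local Notation cst := (env_cst (lb_bracket X)).
Local Notation sym := (env_sym (lb_bracket X)).

Definition qm_env (a : env) : fseries M := qm_map Phi (urep a).

Lemma qm_env_ucl p : qm_env (ucl (lb_bracket X) p) = qm_map Phi p.
Proof.
apply/funext => r; apply/funext => x; apply: qm_wd; exact: urep_ucl.
Qed.

Lemma qm_env_smooth a : fsmooth (qm_env a).
Proof. exact: qm_smooth. Qed.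

Lemma qm_envD a b r x : qm_env (a + b) r x = qm_env a r x + qm_env b r x.
Proof. by rewrite -[a + b]/(ucl _ _) qm_env_ucl qm_add. Qed.

Lemma qm_envM a b : qm_env (a * b) = star S (qm_env a) (qm_env b).
Proof.
rewrite -[a * b]/(ucl _ _) qm_env_ucl.
by apply/funext => r; apply/funext => x; rewrite qm_mul.
Qed.

Lemma qm_envZ c a r x : qm_env (cst c * a) r x = c * qm_env a r x.
Proof.
rewrite -{1}(urepK a) -uclM qm_env_ucl qm_scale /fseries_scale big_ord_recl /=.
by rewrite subn0 big1 ?addr0 // => k _; rewrite /cseries_cst /= mul0r.
Qed.

Lemma qm_polE u : qm_pol Phi u = qm_env (sym u).
Proof. by rewrite /qm_pol /env_sym qm_env_ucl. Qed.

Lemma qm_pol_linear r x c u v :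
  qm_pol Phi (c *: u + v) r x = c * qm_pol Phi u r x + qm_pol Phi v r x.
Proof. by rewrite !qm_polE env_symD qm_envD env_symZ qm_envZ. Qed.

Lemma filtered_exp a K c y b : star_order S a K c y ->
  filtered a K c 1 y (qm_env b) ->
  forall d, filtered a K c d y (qm_env (b ^+ d)).
Proof.
move=> So b1; elim=> [|d IH] r Kr //.
rewrite exprS qm_envM -add1n.
exact: So (qm_env_smooth b) (qm_env_smooth (b ^+ d)) b1 IH r Kr.
Qed.

Variable J : M -> 'rV[R]_n.
Hypothesis PhiJ : classical_part Phi J.

(* [X_t - t(J x)] has weight 1 because its classical part vanishes at [x], so
   its [d]-th power has weight [d]; these powers span by polarization. *)
Lemma qm_pol_recenter_eq0 a K c x : dom a x -> (0 < c)%N ->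
  star_order S a K c (chart a x) ->
  forall r I, K r -> (c * r < mdeg I)%N ->
  qm_pol Phi (recenter (J x) (mpolyX R[i] I)) r x = 0.
Proof.
move=> ax c0 So r I Kr rI.
have linL := linL_recenter (J x) (qm_pol_linear r x).
apply: (polarization linL _ (erefl (mdeg I))) => t.
(* [q] is the linear form [t.(mu - J x)], and [k] is its constant term. *)
pose k := - \sum_l (t l)%:C%C * (J x 0 l)%:C%C.
pose q : mpoly n R[i] := \sum_l (t l)%:C%C *: mpolyX R[i] (mnm1 l) + mpolyC n k.
have recE : recenter (J x) (\sum_l (t l)%:C%C *: mpolyX R[i] (mnm1 l)) = q.
  rewrite /recenter (big_morph _ (shift_mpolyD _) (shift_mpoly0 _)).
  rewrite /q /k -sumrN (big_morph _ (@mpolyCD n _) (mpolyC0 n _)) -big_split.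
  apply: eq_bigr => l _; rewrite shift_mpolyZ shift_mpolyX scalerDr -mulrN.
  by rewrite mpolyCM mul_mpolyC.
have recX d : recenter (J x) ((\sum_l (t l)%:C%C *: mpolyX R[i] (mnm1 l)) ^+ d)
    = q ^+ d.
  rewrite -recE; elim: d => [|d IH]; first by rewrite !expr0 /recenter shift_mpoly1.
  by rewrite !exprS /recenter shift_mpolyM -IH.
rewrite recX qm_polE env_sym_shift_exp; set b := \sum_l _ + _.
have bE : b = sym q by rewrite -[b]expr1 -env_sym_shift_exp expr1.
(* On [lambda^0], weight 1 means that [t.(J - J x)] vanishes at [x]; on higher powers [1 - c r] is
   truncated to [0] because [c] is positive. *)
have b1 : filtered a K c 1 (chart a x) (qm_env b).
  move=> [|r'] _; last first.
    by rewrite (_ : 1 - c * r'.+1 = 0)%N //; nia.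
  rewrite muln0 subn0; split=> // /=.
  rewrite mf_chartK // bE -qm_polE PhiJ -recE /pol_fun /recenter meval_shift.
  rewrite (meval_eq (v2 := fun=> 0)); last by move=> l; rewrite subrr.
  rewrite meval_mcoeff0 raddf_sum big1 // => l _ /=.
  rewrite mcoeffZ mcoeffX; case: eqP => [/(congr1 mdeg)|_]; rewrite ?mulr0 //.
  by rewrite mdeg1 mdeg0.
have := filtered_exp So b1 (mdeg I) Kr.
case: (mdeg I - c * r)%N (subn_gt0 (c * r)%N (mdeg I)) => [|e]; first by rewrite rI.
by move=> _ [/=]; rewrite mf_chartK.
Qed.

(** [J] is given as a mere map; its components are smooth as classical parts of the images of the
    linear coordinates. *)
Lemma csmooth_momentum l : csmooth (fun x => (J x 0 l)%:C%C).
Proof.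
apply: eq_csmooth (qm_env_smooth (sym (mpolyX R[i] (mnm1 l))) 0%N) => x.
by rewrite -qm_polE PhiJ pol_funX.
Qed.

(** The argument of [Phi] varies with [x] only through its coefficients: multiplying out the factors
    [mu_l - J_l(x)] gives values on fixed monomials with coefficients polynomial in the [J_l]. *)
Lemma csmooth_qm_pol_recenter I r :
  csmooth (fun x => qm_pol Phi (recenter (J x) (mpolyX R[i] I)) r x).
Proof.
(* [K] collects the variables chosen from the factors already multiplied out. *)
have word s K : csmooth (fun x => qm_pol Phi
    (mpolyX R[i] K * \prod_(l <- s) recenter (J x) (mpolyX R[i] (mnm1 l))) r x).
  elim: s K => [|l s IH] K.
    apply: eq_csmooth (qm_env_smooth (sym (mpolyX R[i] K)) r) => x.
    by rewrite -qm_polE big_nil mulr1.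
  have sl := csmoothM (csmooth_cst (-1)) (csmooth_momentum l).
  apply: eq_csmooth (csmoothD (csmoothM sl (IH K)) (IH (mnm_add K (mnm1 l)))) => x.
  rewrite -qm_pol_linear big_cons mulN1r; congr (qm_pol Phi _ r x).
  rewrite /recenter shift_mpolyX mulrA mulrDr mulrDl addrC mpolyXD.
  by rewrite (mulrC (mpolyX R[i] K) (mpolyC _ _)) mul_mpolyC -scalerAl.
apply: eq_csmooth (word (multinom_word I) mnm0) => x.
rewrite mpolyX0 mul1r; congr (qm_pol Phi _ r x).
rewrite mpolyXE_id /recenter (big_morph _ (shift_mpolyM _) (shift_mpoly1 _)).
rewrite /multinom_word big_flatten big_map big_enum /=; apply: eq_bigr => l _.
rewrite big_nseq; elim: (I l) => [|k IH]; first by rewrite expr0 shift_mpoly1.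
by rewrite iterS exprS shift_mpolyM IH.
Qed.

End QuantumMomentMap.

(** * Star products of Fedosov type *)

Section SmoothVanishing.
Context {R : realType} {m : nat}.
Variables (W : set 'rV[R]_m) (openW : open W) (y : 'rV[R]_m) (Wy : W y).
Implicit Types (u v : 'rV[R]_m -> R[i]) (k : nat).

(** Vanishing is paired with smoothness, which the rules for sums and products ask for, so that
    nested sums are treated in one pass. *)
Definition vsmooth k u : Prop := csmooth_on W u /\ vanishes k u y.

Lemma eq_vsmooth k u v :
  (forall z, W z -> u z = v z) -> vsmooth k u -> vsmooth k v.
Proof.
move=> uv [su vu]; split; first exact: (eq_csmooth_on openW uv su).
exact: (eq_vanishes openW uv Wy vu).
Qed.

Lemma vsmooth_le k k' u : (k <= k')%N -> vsmooth k' u -> vsmooth k u.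
Proof. by move=> kk' [su vu]; split; [exact: su|exact: (vanishes_le kk' vu)]. Qed.

Lemma vsmooth0 k : vsmooth k (fun=> 0).
Proof. by split; [exact: csmooth_on_cst|exact: vanishes0]. Qed.

Lemma vsmoothD k u v :
  vsmooth k u -> vsmooth k v -> vsmooth k (fun z => u z + v z).
Proof.
move=> [su vu] [sv vv]; split; first exact: (csmooth_onD openW su sv).
exact: (vanishesD openW Wy su sv vu vv).
Qed.

Lemma vsmoothM a b k u v : (k <= a + b)%N -> vsmooth a u -> vsmooth b v ->
  vsmooth k (fun z => u z * v z).
Proof.
move=> kab [su vu] [sv vv]; split; first exact: (csmooth_onM openW su sv).
exact: (vanishesM openW kab Wy su sv vu vv).
Qed.

Lemma vsmoothMl k u v : csmooth_on W u -> vsmooth k v ->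
  vsmooth k (fun z => u z * v z).
Proof. by move=> su; apply: (vsmoothM (leqnn (0 + k))); split. Qed.

Lemma vsmoothZ k (c : R[i]) u : vsmooth k u -> vsmooth k (fun z => c * u z).
Proof. exact: (vsmoothMl (csmooth_on_cst openW c)). Qed.

Lemma vsmoothB k u v :
  vsmooth k u -> vsmooth k v -> vsmooth k (fun z => u z - v z).
Proof.
move=> vu vv; apply: eq_vsmooth (vsmoothD vu (vsmoothZ (-1) vv)) => z _.
by rewrite mulN1r.
Qed.

Lemma vsmooth_sum k (I : Type) (r : seq I) (P : pred I)
    (F : I -> 'rV[R]_m -> R[i]) :
  (forall j, P j -> vsmooth k (F j)) ->
  vsmooth k (fun z => \sum_(j <- r | P j) F j z).
Proof.
move=> vF; elim: r => [|j r IH].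
  by apply: eq_vsmooth (vsmooth0 k) => z _; rewrite big_nil.
have [Pj|nPj] := boolP (P j).
  by apply: eq_vsmooth (vsmoothD (vF j Pj) IH) => z _; rewrite big_cons Pj.
by apply: eq_vsmooth IH => z _; rewrite big_cons (negbTE nPj).
Qed.

Lemma vsmooth_cpartial k i u : vsmooth k u -> vsmooth k.-1 (cpartial i u).
Proof.
by move=> [su vu]; split; [exact: csmooth_on_cpartial|exact: vanishes_cpartial].
Qed.

(* [f] prescribes the order of vanishing of the components of a section of the
   Weyl bundle as a function of their total degree. *)
Definition weyl_vanishes (f : nat -> nat) (B : 'rV[R]_m -> weyl R m) : Prop :=
  forall r J, vsmooth (f (r.*2 + mdeg J)%N) (fun z => B z r J).

(** On coefficients, a word of [y]-derivatives is an index shift with a numerical factor. *)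
Lemma foldr_weyl_dyE (s : seq 'I_m) (J : multinom m) :
  exists (k : nat) (J' : multinom m), mdeg J' = (mdeg J + size s)%N /\
    forall (B : weyl R m) r, foldr (@weyl_dy R m) B s r J = k%:R * B r J'.
Proof.
elim: s J => [|i s IH] J.
  by exists 1%N, J; split=> [|B r]; [rewrite addn0|rewrite mul1r].
have [k [J' [dJ' BJ']]] := IH (mnm_add J (mnm1 i)).
exists ((J i).+1 * k)%N, J'; split=> [|B r].
  by rewrite dJ' mdegD mdeg1 addn1 addSnnS.
by rewrite /= {1}/weyl_dy BJ' natrM mulrA.
Qed.

(** The Weyl product preserves the total degree: [lambda^k], of degree [2k], makes up for [k]
    derivatives of each factor. *)
Lemma weyl_vanishes_mul (P : 'rV[R]_m -> 'M[R]_m) f g h A B :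
  (forall i j, smooth_on W (fun z => P z i j)) ->
  (forall p q, (h (p + q) <= f p + g q)%N) ->
  weyl_vanishes f A -> weyl_vanishes g B ->
  weyl_vanishes h (fun z => weyl_mul (P z) (A z) (B z)).
Proof.
move=> sP hfg vA vB r J.
apply: vsmooth_sum => k _; apply: vsmooth_sum => k1 _; apply: vsmooth_sum => k2 kr.
apply: vsmoothZ; apply: vsmooth_sum => I _; apply: vsmooth_sum => I' _.
apply: vsmoothMl.
  apply: csmooth_on_prod => // t; exact: csmooth_on_real.
apply: vsmooth_sum => J1 _; apply: vsmooth_sum => J2 J12.
have [a [K1 [dK1 AE]]] := foldr_weyl_dyE I J1.
have [b [K2 [dK2 BE]]] := foldr_weyl_dyE I' J2.
apply: (@eq_vsmooth _ (fun z => a%:R * A z k1 K1 * (b%:R * B z k2 K2))).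
  by move=> z _; rewrite AE BE.
apply: vsmoothM; [|exact: (vsmoothZ _ (vA k1 K1))|exact: (vsmoothZ _ (vB k2 K2))].
apply: leq_trans (hfg _ _); rewrite dK1 dK2 !size_tuple.
have dJ : mdeg J = (mdeg J1 + mdeg J2)%N by rewrite -mdegD (eqP J12).
suff -> : (r.*2 + mdeg J = k1.*2 + (mdeg J1 + k) + (k2.*2 + (mdeg J2 + k)))%N by [].
by move/eqP: kr; lia.
Qed.

End SmoothVanishing.

Section Fedosov.
Context {R : realType} {m : nat} {M : manifold R m} {w : symplectic_form M}.
Context {N : symplectic_connection w} (F : fedosov_connection N).
Variables (a : idx M).
Let W := chart_image a (dom a).
Let openW : open W := open_chart_image a (mf_open a).
Variables (y : 'rV[R]_m) (Wy : W y).

Lemma smooth_on_omega_inv i j :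
  smooth_on W (fun z => omega_inv w a (param a z) i j).
Proof.
apply: (smooth_on_invmx openW) => [z /chart_imageP[az _ _]|k l].
  exact: omega_nondeg.
exact: omega_smooth.
Qed.

(* The components of a flat section are determined by those of lower degree:
   [delta s] is the covariant derivative of [s] minus [gamma] acting on [s]. *)
Lemma flat_section_vanishes (s : idx M -> M -> weyl R m) (u : fseries M) d :
  flat_section F s -> is_symbol s u ->
  (forall r, vanishes (d - 2 * r) (u r \o param a) y) ->
  weyl_vanishes W y (fun p => d - p)%N (fun z => s a (param a z)).
Proof.
move=> [[ss _] Ds] su vu.
have sB r J : csmooth_on W (fun z => s a (param a z) r J).
  exact: ((csmooth_inP _ _).1 (ss a r J) a).
suff low D r J : (r.*2 + mdeg J < D)%N ->
    vsmooth W y (d - (r.*2 + mdeg J)) (fun z => s a (param a z) r J).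
  by move=> r J; apply: low (ltnSn _).
elim: D r J => [//|D IH] r J; rewrite ltnS leq_eqVlt.
case/orP=> [/eqP dJ|]; last exact: IH.
(* The components without [y] form the symbol, for which the hypothesis on [u] is the bound
   wanted. *)
have [J0|J0] := eqVneq J mnm0.
  split; first exact: sB.
  apply: (eq_vanishes openW (u := u r \o param a) _ Wy).
    by move=> z /chart_imageP[az _ _]; rewrite J0 su.
  by rewrite J0 mdeg0 addn0 -mul2n.
have [k Jk] : exists k, J k != 0%N.
  by move: J0; rewrite -mdeg_eq0 mdegE sum_nat_eq0 negb_forall => /existsP.
pose K := mnm_sub J (mnm1 k).
have JE : J = mnm_add K (mnm1 k).
  rewrite submK //; apply/mnm_lepP => l; rewrite mnm1E.
  by case: eqP => // <-; rewrite lt0n.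
have dK : mdeg J = (mdeg K).+1 by rewrite JE mdegD mdeg1 addn1.
have KD : (r.*2 + mdeg K < D)%N by rewrite -dJ dK addnS.
have dJK : (d - (r.*2 + mdeg J) = (d - (r.*2 + mdeg K)).-1)%N.
  by rewrite dK addnS subnS.
pose P z := omega_inv w a (param a z).
pose B z := s a (param a z).
pose gam z := fed_gamma F a k (param a z).
(* The [dx^k]-component of [D s = 0] at [y^K] says that [K k + 1] times the component at [y^J] is
   [rhs]. *)
pose rhs z := cpartial k (fun z' => B z' r K) z -
  \sum_(l < m) \sum_(j < m) (christoffel N a l k j (param a z))%:C%C *
    weyl_y j (weyl_dy l (B z)) r K - weyl_ad (P z) (gam z) (B z) r K.
apply: (eq_vsmooth openW Wy (u := fun z => ((K k).+1%:R)^-1 * rhs z)).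
  move=> z /chart_imageP[az _ cz]; have := Ds a k _ az r K.
  rewrite /fedosov_D /weyl_nabla /chart_cpartial cz -/(P z) -/(gam z) -/(B z).
  rewrite -addrA -/(rhs z) => /eqP.
  rewrite addrC subr_eq0 => /eqP ->.
  by rewrite /weyl_dy JE mulKf // pnatr_eq0.
apply: (vsmoothZ openW Wy); apply: (vsmoothB openW Wy).
  apply: (vsmoothB openW Wy).
    by rewrite dJK; apply: vsmooth_cpartial; exact: IH.
  apply: (vsmooth_sum openW Wy) => l _; apply: (vsmooth_sum openW Wy) => j _.
  apply: (vsmoothMl openW Wy).
    have sC := @chr_smooth _ _ _ _ N a l k j.
    exact: (csmooth_on_real openW (sC a)).
  rewrite /weyl_y; case: eqP => [_|/eqP Kj]; first exact: vsmooth0.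
  apply: (vsmoothZ openW Wy).
  have dKj : mdeg (mnm_add (mnm_sub K (mnm1 j)) (mnm1 l)) = mdeg K.
    rewrite mdegD mdeg1 -[in RHS](@submK _ (mnm1 j) K) ?mdegD ?mdeg1 //.
    by apply/mnm_lepP => t; rewrite mnm1E; case: eqP => // <-; rewrite lt0n.
  rewrite dJK; apply: (vsmooth_le (leq_pred _)); rewrite -dKj.
  by apply: IH; rewrite dKj.
(* The induction hypothesis covers degrees below [D]; from there on nothing is claimed. *)
have vB : weyl_vanishes W y (fun q => if (q < D)%N then d - q else 0)%N B.
  by move=> r' J'; case: ifP => [|_]; [exact: IH|split; [exact: sB|]].
(* [gamma] is zero below degree 3, so any order may be claimed there, and [d] is enough. *)
have vgam : weyl_vanishes W y (fun p => if (p < 3)%N then d else 0)%N gam.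
  move=> r' J'; case: ifP => [p3|_].
    apply: (eq_vsmooth openW Wy (u := fun=> 0)); last exact: vsmooth0.
    by move=> z /chart_imageP[az _ _]; rewrite /gam fed_degree.
  split=> //; have [sg _] := fed_form F.
  exact: ((csmooth_inP _ _).1 (sg a k r' J') a).
(* Division by [lambda] means that the product is read in degree [D + 1], the only one claimed. As
   [gamma] starts in degree 3, the contributing components of [B] have degree at most [D - 2],
   within reach of the induction hypothesis. *)
pose h s := (if s == D.+1 then d - D else 0)%N.
have hE : h (r.+1.*2 + mdeg K)%N = (d - (r.*2 + mdeg J))%N.
  by rewrite /h; case: eqP; lia.
rewrite -hE /weyl_ad; apply: (vsmoothB openW Wy).
  apply: (weyl_vanishes_mul openW Wy smooth_on_omega_inv _ vgam vB) => p q.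
  by rewrite /h; case: eqP; case: ifP; case: ifP; lia.
apply: (weyl_vanishes_mul openW Wy smooth_on_omega_inv _ vB vgam) => p q.
by rewrite /h; case: eqP; case: ifP; case: ifP; lia.
Qed.

End Fedosov.

(** Components of degree [p] of the two flat sections vanish to orders [d - p] and [e - p]. Degrees
    add up in the Weyl product, whose [lambda^r]-part at [y = 0] has degree [2r]; hence [c = 2], for
    every [r]. *)
Lemma star_order_fedosov (R : realType) (m : nat) (M : manifold R m)
    (w : symplectic_form M) (S : star_product w) (a : idx M) x :
  fedosov_type S -> dom a x -> star_order S a (fun=> True) 2 (chart a x).
Proof.
move=> [N [F [Q [flatQ _ starQ]]]] ax d e f g sf sg vf vg r _.
have openW := open_chart_image a (mf_open a).
have Wy : chart_image a (dom a) (chart a x) by apply: mem_chart_image.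
have [ff fsym] := flatQ f sf; have [fg gsym] := flatQ g sg.
have vQf := flat_section_vanishes Wy ff fsym (fun r => vf r I).
have vQg := flat_section_vanishes Wy fg gsym (fun r => vg r I).
have hd p q : (d + e - (p + q) <= (d - p) + (e - q))%N by lia.
have sP := @smooth_on_omega_inv _ _ _ w a.
have [_] := weyl_vanishes_mul openW Wy sP hd vQf vQg r mnm0.
rewrite mdeg0 addn0 -mul2n; apply: (eq_vanishes openW _ Wy).
by move=> z /chart_imageP[az _ _] /=; rewrite (starQ f g sf sg a _ az r).
Qed.

(** * Differentiability of quantum moment maps and the bound [|I| <= 2j] for Fedosov type *)

Theorem theorem3p3 (R : realType) (m n : nat)
    (M : manifold R m) (w : symplectic_form M)
    (G : lie_group R n) (A : symplectic_action G w)
    (S : star_product w) (X : lie_basis G)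
    (Phi : quantum_moment_map X A S) (J : M -> 'rV[R]_n) :
  star_invariant A S ->
  classical_part Phi J ->
  differentiable_qmm J (qm_pol Phi) /\
  (fedosov_type S ->
   forall Psi : ('rV[R]_n -> R[i]) -> fseries M,
     differentiable_extension J (qm_pol Phi) Psi ->
     exists s : multinom n -> nat -> M -> R[i],
       coeff_smooth s /\
       forall u : 'rV[R]_n -> R[i], csmooth_on setT u ->
         forall (j : nat) (x : M),
           Psi u j x =
           \sum_(I : bmultinom n (2 * j).+1%N) s I j x * Dmu I u (J x)).
Proof.
move=> _ PhiJ; pose L j x u := qm_pol Phi u j x.
have linL j x : forall a u v, L j x (a *: u + v) = a * L j x u + L j x v.
  exact: qm_pol_linear.
pose s I j x := taylor_coeff (J x) (L j x) I.
(* Serves both halves: powers up to [j] with a local [c] for differentiability, all powers with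
   [c = 2] for Fedosov type. *)
have s0 a K c x : dom a x -> (0 < c)%N -> star_order S a K c (chart a x) ->
    forall j, K j -> forall I, (c * j < mdeg I)%N -> s I j x = 0.
  move=> ax c0 So j Kj I jI; apply: taylor_coeff_eq0.
  exact: (qm_pol_recenter_eq0 PhiJ ax c0 So Kj jI).
split.
  exists s; split=> [I j|j x|u j x N sN].
  - exact: (csmoothM (csmooth_cst _) (csmooth_qm_pol_recenter PhiJ I j)).
  - have [a ax] := mf_cover x.
    have [V [c [oV Vx Va c0 So]]] := star_order_near S j ax.
    (* [c] is uniform on [V], so one bound on [|I|] serves all nearby points. *)
    exists (c * j).+1.
    have : nbhs x V by exact: open_nbhs_nbhs.
    apply: filterS => z Vz I jI.
    exact: (s0 _ _ _ _ (Va z Vz) c0 (So z Vz) j (leqnn j) I jI).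
  exact: (taylor_expansion (linL j x) sN).
move=> fedS Psi [PsiT [s' [ss' fs' es']]]; exists s'; split=> // u su j x.
apply: (es') => [|I jI]; first exact: su.
have [N /nbhs_singleton fN] := fs' j x.
(* [Psi] comes with coefficients [s'] of its own. It agrees with [Phi] on polynomials, so uniqueness
   identifies them with the Taylor coefficients [s], whose bound they inherit. *)
have -> : s' I j x = s I j x.
  apply: (taylor_unique fN) => p.
  by rewrite -(es' (pol_fun p) (csmooth_pol_fun p) j x N fN) PsiT.
have [a ax] := mf_cover x.
exact: (s0 _ _ 2%N _ ax isT (star_order_fedosov fedS ax) j Logic.I I jI).
Qed.
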